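(* There exists a universal constant $c>0$ such that the following holds. Let $k\ge 1$ be an integer and let $X_0,\dots,X_{k-1}$ be independent integer-valued random variables with finite means $\mu_j=\mathbb{E}[X_j]$ and finite variances $\sigma_j^2=\mathrm{Var}[X_j]$. Put $X=\sum_{j=0}^{k-1}X_j$, $\mu=\sum_{j=0}^{k-1}\mu_j$ and $\sigma^2=\sum_{j=0}^{k-1}\sigma_j^2$ with $\sigma>0$. If $X$ is monotone, then for every $t\in\mathbb{R}$ for which $\mu+t\sigma$ is an integer, $$\left|\Pr[X=\mu+t\sigma]-\frac{1}{\sqrt{2\pi}\,\sigma}e^{-t^2/2}\right|\le c\left(\frac{\sum_{j=0}^{k-1}\mathbb{E}\left[|X_j-\mu_j|^3\right]}{\sigma^3}\right)^2 .$$
   Context: For a real random variable $X$, its characteristic function is $f_X:\mathbb{R}\to\mathbb{C}$, $f_X(\lambda)=\mathbb{E}[e^{i\lambda X}]$. A real random variable $X$ is called monotone if $\lambda\mapsto|f_X(\lambda)|$ is decreasing (in the weak sense, i.e. non-increasing) on $[0,\pi]$. The variables $X_j$ are not assumed to be identically distributed. Third absolute central moments are taken in $[0,\infty]$; if one of them is infinite the right-hand side is $+\infty$ and the inequality is understood to hold. *)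

(* Defs.v *)
From mathcomp Require Import all_boot all_order all_algebra.
From mathcomp Require Import complex.
From mathcomp Require Import all_classical all_reals all_analysis.
Import Order.TTheory GRing.Theory Num.Theory.
Import numFieldNormedType.Exports.

Set Implicit Arguments.
Unset Strict Implicit.
Unset Printing Implicit Defensive.

Local Open Scope classical_set_scope.
Local Open Scope ring_scope.

Definition integer_valued (T : Type) (R : realType) (X : T -> R) : Prop :=
  forall w, X w \is a Num.int.

(* Mutual independence: the product rule for every finite subfamily. *)
Definition independent_RVs (d : measure_display) (T : measurableType d)
    (R : realType) (P : probability T R) (I : finType)
    (X : I -> {RV P >-> R}) : Prop :=
  forall (J : {set I}) (A : I -> set R), (forall i, measurable (A i)) ->
    P (\bigcap_(i in [set` J]) (X i @^-1` A i)) =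
    (\prod_(i in J) P (X i @^-1` A i))%E.

(* e^(i x), through Euler's formula. *)
Definition expi (R : realType) (x : R) : R[i] := Complex (cos x) (sin x).

(* Expectation of a complex-valued function, taken componentwise; meaningful
   when both components are integrable, e.g. when Z is bounded. *)
Definition cexpectation (d : measure_display) (T : measurableType d)
    (R : realType) (P : probability T R) (Z : T -> R[i]) : R[i] :=
  Complex (fine 'E_P[fun w => complex.Re (Z w)])
          (fine 'E_P[fun w => complex.Im (Z w)]).

Definition char_fun (d : measure_display) (T : measurableType d)
    (R : realType) (P : probability T R) (X : T -> R) (l : R) : R[i] :=
  cexpectation P (fun w => expi (l * X w)).

(* The moduli are compared in R[i], whose order extends that of R: z <= z' iff
   z and z' have the same imaginary part and Re z <= Re z'. *)
Definition monotone_RV (d : measure_display) (T : measurableType d)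
    (R : realType) (P : probability T R) (X : T -> R) : Prop :=
  forall a b : R, 0 <= a -> a <= b -> b <= pi ->
    `|char_fun P X b| <= `|char_fun P X a|.

(* Main.v *)
Require Import Defs.
From mathcomp Require Import all_boot all_order all_algebra.
From mathcomp Require Import complex.
From mathcomp Require Import all_classical all_reals all_analysis.
From mathcomp Require Import measurable_realfun ring lra zify.
Import Order.TTheory GRing.Theory Num.Theory.
Import numFieldNormedType.Exports.
Import Normc.

(** Write [Y_j = X_j - mu_j], [B = \sum_j E|Y_j|^3], [V = sigma^2] and
    [L = B / sigma^3].  If some third moment is infinite the right-hand side
    is [+oo]; otherwise the bound comes from Fourier inversion on the integers,
      [pi * Pr[S = n] = \int_0^pi Re (e^(-i l t sigma) * psi l) dl],
    where [n = mu + t sigma] and [psi l = \prod_j E e^(i l Y_j)] by independence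
    ([lattice_inversion], [cexpectation_prod]), compared with the Gaussian
    integral of the same shape.

    The frequencies are cut at [a = V / (4 B)].  Below [a] the Taylor bounds
    [cf_taylor] for the factors and a telescoping of the product give
      [|psi l - e^(-sigma^2 l^2 / 2)| <= 2 B l^3 e^(-sigma^2 l^2 / 8)]
    ([normc_prod_cf_gauss_le]), whose integral is [O(L / sigma)].  Above [a]
    monotonicity enters: [|psi l| <= |psi a| <= e^(-(sigma a)^2 / 4)], and since
    [sigma a = 1 / (4 L)] this is at most [64 L^2].  The Gaussian integral over
    [[0, a]] differs from the one over the half line by an equally small amount
    ([gauss_cos_integral_decay], [gauss_truncation]); the three contributions
    are put together in [fourier_gauss_bound].

    What turns the usual local error [O(L / sigma)] into [O(L^2)] is that an
    integer-valued variable satisfies [E Y_j^2 <= 2 E|Y_j|^3]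
    ([lattice_variance_le_third_moment]), so that [1 / sigma <= 2 L].  The same
    inequality shows [a <= 1 <= pi], so the cut lies inside the range where the
    modulus of the characteristic function is known to decrease.  When
    [L >= 1/8] the trivial bounds on both quantities suffice. *)

Set Implicit Arguments.
Unset Strict Implicit.
Unset Printing Implicit Defensive.

Local Open Scope classical_set_scope.
Local Open Scope complex_scope.
Local Open Scope ring_scope.

Local Notation leb := lebesgue_measure.

(** * Taylor bounds for cosine, sine and exponential *)

Lemma ge0_of_derive_ge0 (R : realType) (f g : R -> R) :
  (forall x : R, is_derive x 1 f (g x)) -> (forall x, 0 <= x -> 0 <= g x) ->
  0 <= f 0 -> forall x, 0 <= x -> 0 <= f x.
Proof.
move=> fg g0 f0 x; rewrite le_eqVlt => /predU1P[<-//|x0].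
have [|c] := @MVT R f g 0 x x0 (fun y _ => fg y).
  by apply: derivable_within_continuous => y _; exact: ex_derive.
rewrite in_itv/= => /andP[c0 _] fE.
have := mulr_ge0 (g0 _ (ltW c0)) (ltW x0); lra.
Qed.

Lemma sin_le_id (R : realType) (x : R) : 0 <= x -> sin x <= x.
Proof.
move=> x0; rewrite -subr_ge0; move: x x0.
have D (x : R) : is_derive x 1 (fun x => x - sin x) (1 - cos x).
  by apply: trigger_derive; rewrite /GRing.scale/=; lra.
apply: (ge0_of_derive_ge0 D).
- by move=> x _; rewrite subr_ge0 cos_le1.
- by rewrite sin0 subrr.
Qed.

Lemma cos_ge_taylor2 (R : realType) (x : R) : 0 <= cos x - (1 - x ^+ 2 / 2).
Proof.
wlog x0 : x / 0 <= x.
  move=> H; have [/H//|/ltW] := leP 0 x.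
  by rewrite -oppr_ge0 => /H; rewrite cosN sqrrN.
move: x x0.
have D (x : R) :
    is_derive x 1 (fun x => cos x - (1 - x ^+ 2 / 2)) (- sin x + x).
  by apply: trigger_derive; rewrite /GRing.scale/=; lra.
apply: (ge0_of_derive_ge0 D).
- by move=> x /sin_le_id; lra.
- by rewrite cos0 expr0n/=; lra.
Qed.

Lemma sin_ge_taylor3 (R : realType) (x : R) : 0 <= x ->
  0 <= sin x - (x - x ^+ 3 / 6).
Proof.
move: x.
have D (x : R) : is_derive x 1
    (fun x => sin x - (x - x ^+ 3 / 6)) (cos x - (1 - x ^+ 2 / 2)).
  by apply: trigger_derive; rewrite /GRing.scale/=; lra.
apply: (ge0_of_derive_ge0 D).
- by move=> x _; exact: cos_ge_taylor2.
- by rewrite sin0 expr0n/=; lra.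
Qed.

Lemma cos_le_taylor3 (R : realType) (x : R) : 0 <= x ->
  0 <= 1 - x ^+ 2 / 2 + x ^+ 3 / 6 - cos x.
Proof.
move: x.
have D (x : R) : is_derive x 1
    (fun x => 1 - x ^+ 2 / 2 + x ^+ 3 / 6 - cos x) (- x + x ^+ 2 / 2 + sin x).
  by apply: trigger_derive; rewrite /GRing.scale/=; lra.
apply: (ge0_of_derive_ge0 D).
- have D1 (x : R) : is_derive x 1
      (fun x => - x + x ^+ 2 / 2 + sin x) (- 1 + x + cos x).
    by apply: trigger_derive; rewrite /GRing.scale/=; lra.
  apply: (ge0_of_derive_ge0 D1).
  + have D2 (x : R) : is_derive x 1 (fun x => - 1 + x + cos x) (1 - sin x).
      by apply: trigger_derive; rewrite /GRing.scale/=; lra.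
    apply: (ge0_of_derive_ge0 D2).
    * by move=> x _; rewrite subr_ge0 sin_le1.
    * by rewrite cos0; lra.
  + by rewrite sin0 expr0n/=; lra.
- by rewrite cos0 !expr0n/=; lra.
Qed.

Lemma cos_taylor (R : realType) (x : R) :
  `|cos x - (1 - x ^+ 2 / 2)| <= `|x| ^+ 3 / 6.
Proof.
rewrite -cos_norm -[x ^+ 2]real_normK ?num_real//.
rewrite (ger0_norm (cos_ge_taylor2 _)).
by have := cos_le_taylor3 (normr_ge0 x); lra.
Qed.

Lemma sin_taylor (R : realType) (x : R) : `|sin x - x| <= `|x| ^+ 3 / 6.
Proof.
wlog x0 : x / 0 <= x.
  move=> H; have [/H//|/ltW] := leP 0 x.
  by rewrite -oppr_ge0 => /H; rewrite sinN -opprD !normrN.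
rewrite (ger0_norm x0) ler_norml.
by have := sin_ge_taylor3 x0; have := sin_le_id x0; lra.
Qed.

Lemma expR_taylor1 (R : realType) (x : R) : 0 <= x ->
  0 <= expR (- x) - (1 - x) /\ expR (- x) - (1 - x) <= x ^+ 2 / 2.
Proof.
move=> x0; split; first by have := expR_ge1Dx (- x); lra.
rewrite -subr_ge0; move: x x0.
have D (x : R) : is_derive x 1
    (fun x => x ^+ 2 / 2 - (expR (- x) - (1 - x))) (x + expR (-x) - 1).
  by apply: trigger_derive; rewrite /GRing.scale/=; lra.
apply: (ge0_of_derive_ge0 D).
- by move=> x _; have := expR_ge1Dx (- x); lra.
- by rewrite oppr0 expR0; lra.
Qed.

(** The exact order of the error is [y^4], but a bound by [y^3] holds for all
    [y], large ones included, and is what compares with a third moment. *)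
Lemma gauss_taylor (R : realType) (y : R) : 0 <= y ->
  `|expR (- (y ^+ 2 / 2)) - (1 - y ^+ 2 / 2)| <= y ^+ 3.
Proof.
move=> y0; have y2 : 0 <= y ^+ 2 / 2 by have := sqr_ge0 y; lra.
have [h1 h2] := expR_taylor1 y2; rewrite (ger0_norm h1).
have h3 : expR (- (y ^+ 2 / 2)) <= 1.
  by rewrite -[leRHS]expR0 ler_expR; lra.
have y2' := sqr_ge0 y.
have -> : y ^+ 3 = y * y ^+ 2 by rewrite exprS.
have [y1|y1] := leP 1 y.
  by have : y ^+ 2 <= y * y ^+ 2 by [rewrite ler_peMl]; lra.
have zy : y ^+ 2 <= y by rewrite expr2 ler_piMr// ltW.
apply: (le_trans h2); move: y2' zy; set z := y ^+ 2 => z0 zy.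
have zz : z ^+ 2 <= y * z by rewrite expr2 ler_wpM2r.
have -> : (z / 2) ^+ 2 = z ^+ 2 / 4 by field.
have := sqr_ge0 z; lra.

Qed.

(** * Products of characteristic functions against products of Gaussians *)

Section complex_products.
Context {R : realType}.
Implicit Types (x y z : R[i]).

Lemma normc_ge0 z : 0 <= normc z.
Proof. by case: z => a b; exact: sqrtr_ge0. Qed.

Lemma normc_real (a : R) : normc a%:C = `|a|.
Proof. by rewrite /= expr0n/= addr0 sqrtr_sqr. Qed.

Lemma normc_le_ReIm z : normc z <= `|complex.Re z| + `|complex.Im z|.
Proof.
case: z => a b /=.
rewrite -(@ger0_norm _ (`|a| + `|b|)) ?addr_ge0// -sqrtr_sqr ler_wsqrtr//.
rewrite sqrrD !real_normK ?num_real//.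
have := mulr_ge0 (normr_ge0 a) (normr_ge0 b); lra.
Qed.

Lemma normc_ge_Re z : `|complex.Re z| <= normc z.
Proof. by case: z => a b /=; rewrite -sqrtr_sqr ler_wsqrtr// lerDl sqr_ge0. Qed.

Lemma normc_ge_Im z : `|complex.Im z| <= normc z.
Proof. by case: z => a b /=; rewrite -sqrtr_sqr ler_wsqrtr// lerDr sqr_ge0. Qed.

Lemma Re_mul x y :
  complex.Re (x * y) =
  complex.Re x * complex.Re y - complex.Im x * complex.Im y.
Proof. by case: x => ? ?; case: y. Qed.

Lemma Im_mul x y :
  complex.Im (x * y) =
  complex.Re x * complex.Im y + complex.Im x * complex.Re y.
Proof. by case: x => ? ?; case: y. Qed.

Lemma normc_expi (x : R) : normc (expi x) = 1.
Proof. by rewrite /= cos2Dsin2 sqrtr1. Qed.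

Lemma expiD (x y : R) : expi (x + y) = expi x * expi y.
Proof. by rewrite /expi cosD sinD; simpc; rewrite [cos x * sin y + _]addrC. Qed.

Lemma expi0 : expi (0 : R) = 1.
Proof. by rewrite /expi cos0 sin0. Qed.

Lemma expi_sum (I : Type) (r : seq I) (f : I -> R) :
  expi (\sum_(i <- r) f i) = \prod_(i <- r) expi (f i).
Proof.
by apply: (big_morph (@expi R)); [exact: expiD|exact: expi0].
Qed.

Lemma normc_prod_le_expR (I : Type) (r : seq I) (z : I -> R[i]) (m : I -> R) :
  (forall i, normc (z i) <= expR (m i)) ->
  normc (\prod_(i <- r) z i) <= expR (\sum_(i <- r) m i).
Proof.
move=> zm; elim: r => [|i r IH]; first by rewrite !big_nil normc1 expR0.
rewrite !big_cons normcM expRD; apply: ler_pM => //; exact: normc_ge0.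
Qed.

(** Telescoping: the factors are exchanged one at a time, and every factor not
    being exchanged is bounded by [expR (m j)].  The bound on the product of
    the others is written as [expR (\sum_j m j - m i)], a form that induction
    on the sequence preserves. *)
Lemma normc_prodB_le (I : Type) (r : seq I) (z e : I -> R[i]) (m : I -> R) :
  (forall i, normc (z i) <= expR (m i)) ->
  (forall i, normc (e i) <= expR (m i)) ->
  normc (\prod_(i <- r) z i - \prod_(i <- r) e i) <=
  \sum_(i <- r) normc (z i - e i) * expR (\sum_(j <- r) m j - m i).
Proof.
move=> zm em; elim: r => [|i r IH].
  by rewrite !big_nil subrr normc0.
rewrite !big_cons.
have -> : z i * \prod_(j <- r) z j - e i * \prod_(j <- r) e j =
    (z i - e i) * \prod_(j <- r) e j +
    z i * (\prod_(j <- r) z j - \prod_(j <- r) e j).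
  by rewrite mulrBl mulrBr [RHS]addrC addrA subrK.
apply: (le_trans (le_normcD _ _)); rewrite !normcM lerD//.
  apply: ler_wpM2l; first exact: normc_ge0.
  rewrite addrC addKr; exact: normc_prod_le_expR.
apply: (@le_trans _ _ (expR (m i) *
    \sum_(j <- r) normc (z j - e j) * expR (\sum_(k <- r) m k - m j))).
  by apply: ler_pM => //; exact: normc_ge0.
rewrite mulr_sumr ler_sum// => j _.
by rewrite mulrCA -expRD addrA.
Qed.

End complex_products.

Section cf_comparison.
Context {R : realType} {I : finType}.
Variables (l : R) (s b : I -> R) (z : I -> R[i]).
Hypotheses (l0 : 0 <= l) (s0 : forall i, 0 <= s i).
Hypothesis sb : forall i, s i ^+ 3 <= b i.
Hypothesis z1 : forall i, normc (z i) <= 1.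
Hypothesis zE : forall i,
  normc (z i - (1 - (l * s i) ^+ 2 / 2)%:C) <= l ^+ 3 * b i.

Let ls0 i : 0 <= l * s i. Proof. exact: mulr_ge0. Qed.
Let lsb i : (l * s i) ^+ 3 <= l ^+ 3 * b i.
Proof. by rewrite exprMn ler_wpM2l// exprn_ge0. Qed.

Let m i := - ((l * s i) ^+ 2 / 2) + l ^+ 3 * b i.

(** While [(l s_i)^2 <= 2] the Taylor polynomial is nonnegative and
    [1 + x <= e^x] applies.  Beyond that point [b_i >= s_i^3] makes the exponent
    nonnegative, and [|z_i| <= 1] is enough. *)
Lemma normc_cf_le i : normc (z i) <= expR (m i).
Proof.
have [y2|y2] := leP ((l * s i) ^+ 2) 2.
  rewrite -(subrK (1 - (l * s i) ^+ 2 / 2)%:C (z i)).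
  apply: (le_trans (le_normcD _ _)); rewrite normc_real ger0_norm; last lra.
  by have := expR_ge1Dx (m i); have := zE i; rewrite /m; lra.
apply: (le_trans (z1 i)); rewrite -[leLHS]expR0 ler_expR /m.
have y1 : 1 <= l * s i by rewrite leNgt; apply/negP => y1; have := ls0 i; nra.
have : (l * s i) ^+ 2 <= (l * s i) ^+ 3 by rewrite ler_weXn2l.
by have := lsb i; have := sqr_ge0 (l * s i); lra.
Qed.

Lemma normc_cf_gauss_le i :
  normc (z i - (expR (- ((l * s i) ^+ 2 / 2)))%:C) <= 2 * (l ^+ 3 * b i).
Proof.
rewrite -(subrK (1 - (l * s i) ^+ 2 / 2)%:C (z i)) -addrA.
apply: (le_trans (le_normcD _ _)); rewrite -rmorphB normc_real distrC.
by have := gauss_taylor (ls0 i); have := lsb i; have := zE i; lra.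
Qed.

Let V := \sum_i s i ^+ 2.
Let B := \sum_i b i.
Hypothesis lBV : 4 * (l * B) <= V.

Let sum_m : \sum_i m i <= - (l ^+ 2 * V / 4).
Proof.
rewrite /m big_split/= sumrN -mulr_sumr -mulr_suml.
under eq_bigr do rewrite exprMn.
rewrite -mulr_sumr -/V -/B.
have : l ^+ 2 * (4 * (l * B)) <= l ^+ 2 * V by rewrite ler_wpM2l// sqr_ge0.
have -> : l ^+ 2 * (4 * (l * B)) = 4 * (l ^+ 3 * B) by ring.
lra.
Qed.

Lemma normc_prod_cf_le : normc (\prod_i z i) <= expR (- (l ^+ 2 * V / 4)).
Proof.
apply: (le_trans (normc_prod_le_expR _ normc_cf_le)).
by rewrite ler_expR.
Qed.

Hypothesis sV : forall i, s i ^+ 2 <= V / 4.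

(** Exchanging factor [i] leaves out its Gaussian decay [e^(-l^2 s_i^2 / 2)].
    Under [sV] no single variance dominates, so this costs at most
    [e^(l^2 V / 8)] out of the available [e^(-l^2 V / 4)]. *)
Lemma normc_prod_cf_gauss_le :
  normc (\prod_i z i - (expR (- (l ^+ 2 * V / 2)))%:C) <=
  2 * (l ^+ 3 * B) * expR (- (l ^+ 2 * V / 8)).
Proof.
have -> : (expR (- (l ^+ 2 * V / 2)))%:C =
    \prod_i (expR (- ((l * s i) ^+ 2 / 2)))%:C :> R[i].
  rewrite -rmorph_prod -expR_sum; congr (expR _)%:C.
  rewrite sumrN -mulr_suml; under eq_bigr do rewrite exprMn.
  by rewrite -mulr_sumr.
apply: le_trans (normc_prodB_le (m := m) _ _ _) _.
- exact: normc_cf_le.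
- move=> i; rewrite normc_real ger0_norm ?expR_ge0// ler_expR lerDl.
  by rewrite mulr_ge0 ?exprn_ge0// (le_trans _ (sb i))// exprn_ge0.
rewrite [X in 2 * X]mulr_sumr mulr_sumr mulr_suml; apply: ler_sum => i _.
apply: ler_pM; [exact: normc_ge0|exact: expR_ge0|exact: normc_cf_gauss_le|].
rewrite ler_expR /m.
have b0 : 0 <= l ^+ 3 * b i.
  by rewrite mulr_ge0 ?exprn_ge0// (le_trans _ (sb i))// exprn_ge0.
have : l ^+ 2 * s i ^+ 2 <= l ^+ 2 * (V / 4) by rewrite ler_wpM2l ?sqr_ge0.
have := sum_m; rewrite exprMn; lra.
Qed.

End cf_comparison.

(** * The Fourier integral of a truncated Gaussian *)

Lemma derivable_continuous (R : realType) (f : R -> R) :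
  (forall x, derivable f x 1) -> continuous f.
Proof.
by move=> df x; apply/differentiable_continuous/derivable1_diffP; exact: df.
Qed.

Lemma continuous_itv_integrable (R : realType) (f : R -> R) (a b : R) :
  continuous f -> leb.-integrable `[a, b] (EFin \o f).
Proof.
move=> cf; apply: continuous_compact_integrable.
  exact: segment_compact.
exact: continuous_subspaceT.
Qed.

Lemma Rintegral_derive (R : realType) (F f : R -> R) (a b : R) : a < b ->
  (forall x : R, is_derive x 1 F (f x)) -> continuous f ->
  \int[leb]_(x in `[a, b]) f x = F b - F a.
Proof.
move=> ab dF cf; rewrite /Rintegral.
have cF : continuous F by apply: derivable_continuous => x; exact: ex_derive.
rewrite (@continuous_FTC2 R f F)//.
- exact: continuous_subspaceT.
- split; [by move=> x _; exact: ex_derive| |].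
  + exact/cvg_at_right_filter/cF.
  + exact/cvg_at_left_filter/cF.
- by move=> x _; rewrite derive1E; exact: derive_val.
Qed.

Lemma Rintegral_cube_gauss_le (R : realType) (s a : R) : 0 < s -> 0 < a ->
  \int[leb]_(l in `[0, a]) (l ^+ 3 * expR (- (l ^+ 2 * s ^+ 2 / 8))) <=
    32 / s ^+ 4.
Proof.
move=> s0 a0; have sn0 : s != 0 by rewrite gt_eqF.
(* the antiderivative, found by parts in the variable (s l)^2 *)
pose F l := - ((4 * l ^+ 2 * s ^+ 2 + 32) / s ^+ 4
             * expR (- (l ^+ 2 * s ^+ 2 / 8))).
have dF (x : R) : is_derive x 1 F (x ^+ 3 * expR (- (x ^+ 2 * s ^+ 2 / 8))).
  apply: trigger_derive; rewrite /GRing.scale/=; field.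
  exact: sn0.
rewrite (Rintegral_derive a0 dF); last first.
  by apply: derivable_continuous => x; exact: ex_derive.
rewrite /F expr0n/= mulr0 !mul0r oppr0 expR0 add0r.
rewrite opprK mulr1 gerDr oppr_le0 mulr_ge0 ?expR_ge0//.
rewrite divr_ge0 ?exprn_ge0 ?ltW//.
by rewrite addr_gt0// !mulr_gt0// exprn_gt0.
Qed.

Section gauss_fourier.
Variables (R : realType) (s a : R).
Hypotheses (s0 : 0 < s) (a0 : 0 < a).

Let f (t l : R) := expR (- ((s * l) ^+ 2 / 2)) * cos (t * (s * l)).
Let K (t : R) := \int[leb]_(l in `[0, a]) f t l.

Let f' (t l : R) :=
  - (expR (- ((s * l) ^+ 2 / 2)) * (s * l) * sin (t * (s * l))).

Let intf t : leb.-integrable `[0, a] (EFin \o f t).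
Proof.
apply: continuous_itv_integrable; apply: derivable_continuous => l.
exact: ex_derive.
Qed.

Let df (t l : R) : is_derive t 1 (f ^~ l) (f' t l).
Proof.
by apply: trigger_derive; rewrite /GRing.scale/= /f'; ring.
Qed.

Let f'E t l : partial1of2 f t l = f' t l.
Proof. by rewrite partial1of2E; have [_ ->] := df t l. Qed.

Let dK (t : R) : is_derive t 1 K (\int[leb]_(l in `[0, a]) f' t l).
Proof.
have ub x y : `](t - 1), (t + 1)[%classic x -> `[0, a]%classic y ->
    `|partial1of2 f x y| <= cst (s * a) y.
  move=> _; rewrite /= in_itv/= => /andP[y0 ya]; rewrite f'E /f' normrN !normrM.
  rewrite (@le_trans _ _ (1 * (s * a) * 1)) ?mulr1 ?mul1r//.
  have sy : `|s| * `|y| <= s * a.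
    by rewrite !ger0_norm ?ler_pM2l// ltW.
  rewrite -[leRHS]mulr1 ler_pM ?sin_max ?mulr_ge0//.
  rewrite -[leRHS]mul1r ler_pM ?mulr_ge0// ger0_norm ?expR_ge0//.
  by rewrite -[leRHS]expR0 ler_expR oppr_le0 divr_ge0 ?sqr_ge0.
have It : `](t - 1), (t + 1)[%classic t by rewrite /= in_itv/=; lra.
have mB : measurable (`[0, a]%classic : set R) by exact: measurable_itv.
have d1f x y : `](t - 1), (t + 1)[%classic x -> `[0, a]%classic y ->
    derivable (f ^~ y) x 1 by move=> _ _; exact: ex_derive.
have intG : leb.-integrable `[0, a] (EFin \o cst (s * a)).
  by apply: continuous_itv_integrable; exact: cst_continuous.
have G0 (y : R) : 0 <= cst (s * a) y by rewrite /= mulr_ge0 ?ltW.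
have D := @derivable_under_integral R _ _ leb f `[0, a]%classic mB
  t (t - 1) (t + 1) It (fun x _ => intf x) d1f
  (cst (s * a)) G0 intG ub.
have E := @differentiation_under_integral R _ _ leb f `[0, a]%classic mB
  t (t - 1) (t + 1) It (fun x _ => intf x) d1f
  (cst (s * a)) G0 intG ub.
apply: DeriveDef => //.
rewrite -derive1E E; apply: eq_Rintegral => l _; exact: f'E.
Qed.

(** Integration by parts turns the derivative of [K] into the equation
    [K' = - t K + r] of the Gaussian, with [|r| <= rho]. *)
Let K'E t : \int[leb]_(l in `[0, a]) f' t l =
  - t * K t + expR (- ((s * a) ^+ 2 / 2)) * sin (t * (s * a)) / s.
Proof.
pose F l := expR (- ((s * l) ^+ 2 / 2)) * sin (t * (s * l)) / s.
have dF (l : R) : is_derive l 1 F (f' t l + t * f t l).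
  apply: trigger_derive; rewrite /GRing.scale/= /f' /f; field.
  by rewrite gt_eqF.
have cf' : continuous (f' t).
  by apply: derivable_continuous => x; exact: ex_derive.
have intf' := @continuous_itv_integrable R (f' t) 0 a cf'.
have cf : continuous (fun l => f' t l + t * f t l).
  by apply: derivable_continuous => x; exact: ex_derive.
have inttf : leb.-integrable `[0, a] (EFin \o (fun l => t * f t l)).
  apply: continuous_itv_integrable.
  by apply: derivable_continuous => x; exact: ex_derive.
have := Rintegral_derive a0 dF cf.
rewrite RintegralD//; try exact: measurable_itv.
rewrite RintegralZl//; try exact: measurable_itv.
rewrite /F mulr0 mulr0 sin0 mulr0 mul0r subr0 -/(K t); lra.
Qed.

Let K0 t : K (- t) = K t.
Proof. by apply: eq_Rintegral => l _; rewrite /f mulNr cosN. Qed.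

Let rho := expR (- ((s * a) ^+ 2 / 2)) / s.

Let rho0 : 0 < rho. Proof. by rewrite divr_gt0// expR_gt0. Qed.

(** The function [2 - e^(-t)] satisfies [h' + t h >= 1] and [h 0 >= 0], so
    [rho] times it dominates the effect of the boundary term [r] on both sides
    ([e = 1] and [e = -1]).  Being bounded, it keeps the error uniform in [t],
    which integrating [|r| <= rho] over [[0, t]] would not. *)
Let K_compare (e t : R) : `|e| <= 1 -> 0 <= t ->
  0 <= rho * (expR (t ^+ 2 / 2) * (2 - expR (- t))) -
       e * (expR (t ^+ 2 / 2) * K t - K 0).
Proof.
move=> e1 t0.
have D (x : R) : is_derive x 1 (fun t =>
    rho * (expR (t ^+ 2 / 2) * (2 - expR (- t))) -
       e * (expR (t ^+ 2 / 2) * K t - K 0))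
  (expR (x ^+ 2 / 2) * rho * (x * (2 - expR (- x)) + expR (- x)
    - e * sin (x * (s * a)))).
  have dKt := dK x; rewrite K'E in dKt.
  apply: trigger_derive; rewrite /GRing.scale/= /rho; field.
  by rewrite gt_eqF.
apply: (ge0_of_derive_ge0 D) => //.
- move=> x x0; apply: mulr_ge0; first by rewrite mulr_ge0 ?expR_ge0// ltW.
  have h1 : e * sin (x * (s * a)) <= 1.
    apply: le_trans (ler_norm _) _.
    by rewrite normrM mulr_ile1 ?sin_max.
  have h2 := expR_ge1Dx (- x).
  have h3 : expR (- x) <= 1 by rewrite -[leRHS]expR0 ler_expR; lra.
  have : 0 <= x * (1 - expR (- x)) by rewrite mulr_ge0// subr_ge0.
  lra.
- rewrite expr0n/= mul0r oppr0 expR0 !mul1r subrr mulr0 subr0.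
  by have := rho0; lra.
Qed.

Lemma gauss_cos_integral_decay t :
  `|K t - expR (- (t ^+ 2 / 2)) * K 0| <= 2 * rho.
Proof.
wlog t0 : t / 0 <= t.
  move=> H; have [/H//|/ltW] := leP 0 t.
  by rewrite -oppr_ge0 => /H; rewrite K0 sqrrN.
have E : expR (- (t ^+ 2 / 2)) * expR (t ^+ 2 / 2) = 1.
  by rewrite -expRD addNr expR0.
set u := expR (- (t ^+ 2 / 2)) in E *; set v := expR (t ^+ 2 / 2) in E *.
have u0 : 0 <= u by exact: expR_ge0.
have n1 : `|1| <= 1 :> R by rewrite normr1.
have n2 : `|-1| <= 1 :> R by rewrite normrN normr1.
have := mulr_ge0 u0 (K_compare n1 t0); have := mulr_ge0 u0 (K_compare n2 t0).
rewrite -/v.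
have w0 := mulr_ge0 (ltW rho0) (expR_ge0 (- t)); set w := expR (- t) in w0 *.
have -> : u * (rho * (v * (2 - w)) - -1 * (v * K t - K 0)) =
   (u * v) * (rho * (2 - w) + K t) - u * K 0 by ring.
have -> : u * (rho * (v * (2 - w)) - 1 * (v * K t - K 0)) =
   (u * v) * (rho * (2 - w) - K t) + u * K 0 by ring.
rewrite E ler_norml; lra.
Qed.

End gauss_fourier.

Lemma integral0y_gauss_scaled (R : realType) (c : R) : 0 < c ->
  (\int[leb]_(x in `[0%R, +oo[) (expR (- ((c * x) ^+ 2 / 2)))%:E =
   (Num.sqrt (2 * pi) / (2 * c))%:E)%E.
Proof.
move=> c0; have cn0 : c != 0 by rewrite gt_eqF.
have cV0 : c^-1 != 0 by rewrite invr_eq0.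
have pE x : normal_pdf 0 c^-1 x =
    (c / Num.sqrt (2 * pi)) * expR (- ((c * x) ^+ 2 / 2)).
  rewrite normal_pdfE// /normal_peak /normal_fun subr0; congr (_ * expR _).
    have -> : c^-1 ^+ 2 * pi *+ 2 = (c^-1) ^+ 2 * (2 * pi).
      by rewrite mulr2n; ring.
    rewrite sqrtrM ?sqr_ge0// sqrtr_sqr ger0_norm ?invr_ge0 ?ltW//.
    by rewrite invfM invrK.
  by rewrite mulr2n; field.
have s2pi : Num.sqrt (2 * pi) != 0 :> R.
  by rewrite gt_eqF// sqrtr_gt0 mulr_gt0// pi_gt0.
have g0 (x : R) : 0 <= expR (- ((c * x) ^+ 2 / 2)) by exact: expR_ge0.
have cg : continuous (fun x : R => expR (- ((c * x) ^+ 2 / 2))).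
  by apply: derivable_continuous => x; exact: ex_derive.
have := @integral_normal_pdf R 0 c^-1.
under eq_integral do rewrite pE EFinM.
rewrite ge0_integralZl//; last first.
- by rewrite lee_fin divr_ge0 ?sqrtr_ge0// ltW.
- by apply/measurable_EFinP; exact: continuous_measurable_fun.
rewrite ge0_symfun_integralT//; last by move=> x/=; rewrite mulrN sqrrN.
rewrite (_ : [set x | 0 <= x] = `[0, +oo[%classic); last first.
  by apply/seteqP; split => x/=; rewrite in_itv/= andbT.
set I := integral _ _ _ => IE.
have : I \is a fin_num.
  have I0 : (0 <= I)%E by apply: integral_ge0 => x _; rewrite lee_fin.
  rewrite ge0_fin_numE// ltey; apply/eqP => Iy; move: IE.
  rewrite Iy gt0_muley// gt0_muley// lte_fin.
  by rewrite divr_gt0// lt0r s2pi sqrtr_ge0.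
move=> /fineK Ifin; move: IE; rewrite -Ifin -!EFinM => -[IE]; congr _%:E.
apply: (mulfI (_ : 2 * (c / Num.sqrt (2 * pi)) != 0)).
  by rewrite !mulf_neq0 ?invr_eq0.
by rewrite -mulrA mulrCA IE; field; rewrite s2pi cn0.
Qed.

Section gauss_truncation.
Variables (R : realType) (s a : R).
Hypotheses (s0 : 0 < s) (a0 : 0 < a).

Let g (c x : R) := expR (- ((c * x) ^+ 2 / 2)).

Let cg c : continuous (g c).
Proof. by apply: derivable_continuous => x; exact: ex_derive. Qed.

Let intg c : 0 < c -> leb.-integrable `[0, +oo[ (EFin \o g c).
Proof.
move=> c0; apply/integrableP; split.
  apply/measurable_EFinP/measurable_funTS.
  exact: continuous_measurable_fun.
under eq_integral do rewrite /= ger0_norm ?expR_ge0//.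
by rewrite integral0y_gauss_scaled// ltry.
Qed.

Let RintgE c : 0 < c ->
  \int[leb]_(x in `[0, +oo[) g c x = Num.sqrt (2 * pi) / (2 * c).
Proof. by move=> c0; rewrite /Rintegral integral0y_gauss_scaled. Qed.

(** Half of the exponent pays for the smallness of the tail, the other half
    is integrated over the whole half line. *)
Lemma gauss_truncation :
  `|\int[leb]_(x in `[0, a]) expR (- ((s * x) ^+ 2 / 2)) -
    Num.sqrt (2 * pi) / (2 * s)| <= 2 * (expR (- ((s * a) ^+ 2 / 4)) / s).
Proof.
have itf := intg s0.
have s2 : 0 < s / Num.sqrt 2 by rewrite divr_gt0// sqrtr_gt0.
have itf2 := intg s2.
have sub : `]a, +oo[ `<=` `[0, +oo[.
  by move=> x/=; rewrite !in_itv/= !andbT => /ltW; apply: le_trans; exact: ltW.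
rewrite distrC -RintgE// -/(g s) (Rintegral_itvB itf)//; last first.
  by rewrite bnd_simp ltW.
rewrite ger0_norm; last by apply: Rintegral_ge0 => x _; exact: expR_ge0.
have e0 := expR_ge0 (- ((s * a) ^+ 2 / 4)).
have q : Num.sqrt 2 != 0 :> R by rewrite gt_eqF// sqrtr_gt0.
have I2 : leb.-integrable `[0, +oo[
    (EFin \o (fun x => expR (- ((s * a) ^+ 2 / 4)) * g (s / Num.sqrt 2) x)).
  by apply: eq_integrable (integrableZl _ _ itf2) => //.
apply: (@le_trans _ _ (\int[leb]_(x in `]a, +oo[)
    (expR (- ((s * a) ^+ 2 / 4)) * g (s / Num.sqrt 2) x))).
  apply: le_Rintegral => //.
  - exact: integrableS itf.
  - exact: integrableS I2.
  - move=> x/=; rewrite in_itv/= andbT => ax.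
    rewrite /g -expRD ler_expR.
    have -> : (s / Num.sqrt 2 * x) ^+ 2 = (s * x) ^+ 2 / 2.
      by rewrite mulrAC exprMn exprVn sqr_sqrtr.
    have : (s * a) ^+ 2 <= (s * x) ^+ 2.
      by rewrite ler_sqr ?nnegrE ?mulr_ge0 ?ler_pM2l// ltW// (lt_trans a0).
    lra.
apply: (@le_trans _ _ (\int[leb]_(x in `[0, +oo[)
    (expR (- ((s * a) ^+ 2 / 4)) * g (s / Num.sqrt 2) x))).
  rewrite -(Rintegral_itvB I2)//; last by rewrite bnd_simp ltW.
  rewrite lerBlDr lerDl; apply: Rintegral_ge0 => x _.
  by rewrite mulr_ge0 ?expR_ge0.
rewrite RintegralZl// RintgE// [leRHS]mulrCA ler_wpM2l//.
have -> : Num.sqrt (2 * pi) / (2 * (s / Num.sqrt 2)) = Num.sqrt pi / s :> R.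
  have -> : 2 * (s / Num.sqrt 2) = Num.sqrt 2 * s :> R.
    by rewrite -{1}(sqr_sqrtr (ler0n R 2)); field.
  by rewrite sqrtrM//; field; rewrite q gt_eqF.
rewrite ler_pM2r ?invr_gt0//.
have -> : 2 = Num.sqrt (2 ^+ 2) :> R by rewrite sqrtr_sqr ger0_norm.
rewrite ler_wsqrtr//; have := @pihalf_lt2 R; lra.
Qed.
End gauss_truncation.

(** * Splitting the frequency interval *)

(** For [q] the integrand of the inversion formula.  The three error terms come
    from the frequencies below [a], from those above [a], and from cutting the
    Gaussian integral at [a]. *)
Lemma fourier_gauss_bound (R : realType) (q : R -> R) (s a t D E : R) :
  0 < s -> 0 < a -> a <= pi -> 0 <= D ->
  leb.-integrable `[0, pi] (EFin \o q) ->
  (forall l, 0 <= l <= a ->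
    `|q l - expR (- ((s * l) ^+ 2 / 2)) * cos (t * (s * l))| <=
    D * (l ^+ 3 * expR (- (l ^+ 2 * s ^+ 2 / 8)))) ->
  (forall l, a <= l <= pi -> `|q l| <= E) ->
  `|\int[leb]_(l in `[0, pi]) q l
    - Num.sqrt (2 * pi) / (2 * s) * expR (- (t ^+ 2 / 2))| <=
  D * (32 / s ^+ 4) + pi * E + 4 * (expR (- ((s * a) ^+ 2 / 4)) / s).
Proof.
move=> s0 a0 api D0 iq q_near q_far.
set e := expR (- ((s * a) ^+ 2 / 4)).
have e_le : expR (- ((s * a) ^+ 2 / 2)) <= e.
  by rewrite ler_expR; have := sqr_ge0 (s * a); lra.
pose G l := expR (- ((s * l) ^+ 2 / 2)) * cos (t * (s * l)).
have sub1 : `[0, a] `<=` `[0, pi :> R].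
  by apply: subset_itvl; rewrite bnd_simp.
have sub2 : `]a, pi] `<=` `[0, pi :> R].
  move=> x /=; rewrite !in_itv/= => /andP[ax ->].
  by rewrite andbT ltW// (lt_trans a0).
have iqa : leb.-integrable `[0, a] (EFin \o q).
  by apply: integrableS iq => //; exact: measurable_itv.
have iqpi : leb.-integrable `]a, pi] (EFin \o q).
  by apply: integrableS iq => //; exact: measurable_itv.
have iG : leb.-integrable `[0, a] (EFin \o G).
  apply: continuous_itv_integrable; apply: derivable_continuous => l.
  exact: ex_derive.
have qG : `|\int[leb]_(l in `[0, a]) q l - \int[leb]_(l in `[0, a]) G l| <=
    D * (32 / s ^+ 4).
  rewrite -RintegralB//.
  have iqG : leb.-integrable `[0, a] (EFin \o (fun l => q l - G l)).
    by apply: eq_integrable (integrableB _ iqa iG) => //; exact: measurable_itv.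
  apply: le_trans (le_normr_Rintegral _ iqG) _; first exact: measurable_itv.
  have iC : leb.-integrable `[0, a]
      (EFin \o (fun l => l ^+ 3 * expR (- (l ^+ 2 * s ^+ 2 / 8)))).
    apply: continuous_itv_integrable; apply: derivable_continuous => l.
    exact: ex_derive.
  apply: (@le_trans _ _ (\int[leb]_(l in `[0, a])
      (D * (l ^+ 3 * expR (- (l ^+ 2 * s ^+ 2 / 8)))))).
    apply: le_Rintegral => //.
    - by have /integrable_abse := iqG; apply: eq_integrable.
    - by apply: eq_integrable (integrableZl _ D iC).
  rewrite RintegralZl//.
  by rewrite ler_wpM2l// Rintegral_cube_gauss_le.
have qpi : `|\int[leb]_(l in `]a, pi]) q l| <= pi * E.
  have E0 : 0 <= E.
    by apply: le_trans (q_far pi _); rewrite ?normr_ge0// api lexx.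
  apply: le_trans (le_normr_Rintegral _ iqpi) _; first exact: measurable_itv.
  apply: (@le_trans _ _ (\int[leb]_(l in `]a, pi]) E)).
    apply: le_Rintegral => //.
    - by have /integrable_abse := iqpi; apply: eq_integrable.
    - have : leb.-integrable `[0, pi] (EFin \o cst E).
        by apply: continuous_itv_integrable; exact: cst_continuous.
      by apply: integrableS => //; exact: measurable_itv.
    - move=> l /=; rewrite in_itv/= => /andP[al lpi].
      by apply: q_far; rewrite lpi ltW.
  rewrite Rintegral_cst//.
  rewrite mulrC ler_wpM2r// /= lebesgue_measure_itv/= lte_fin.
  by case: ltP => _ /=; [rewrite gerBl ltW|exact: pi_ge0].
have decay : `|\int[leb]_(l in `[0, a]) G l - _| <= _ :=
  @gauss_cos_integral_decay R s a s0 a0 t.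
have trunc := @gauss_truncation R s a s0 a0.
have G0 : \int[leb]_(l in `[0, a])
    (expR (- ((s * l) ^+ 2 / 2)) * cos (0 * (s * l))) =
    \int[leb]_(l in `[0, a]) expR (- ((s * l) ^+ 2 / 2)).
  by apply: eq_Rintegral => l _; rewrite mul0r cos0 mulr1.
rewrite G0 in decay.
have split_q : \int[leb]_(l in `[0, pi]) q l =
    \int[leb]_(l in `[0, a]) q l + \int[leb]_(l in `]a, pi]) q l.
  by rewrite -(Rintegral_itvB iq)// ?bnd_simp ?ltW//; ring.
rewrite split_q.
set u := expR (- (t ^+ 2 / 2)) in decay *.
have u0 : 0 <= u by exact: expR_ge0.
have u1 : u <= 1 by rewrite /u -[leRHS]expR0 ler_expR; have := sqr_ge0 t; lra.
set K0 := \int[leb]_(l in `[0, a]) expR _ in decay trunc.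
set H := Num.sqrt _ / _ in trunc *.
have trunc' : `|u * K0 - H * u| <= 2 * (e / s).
  rewrite [H * u]mulrC -mulrBr normrM ger0_norm//.
  apply: le_trans trunc; exact: ler_piMl.
have es : expR (- ((s * a) ^+ 2 / 2)) / s <= e / s.
  by rewrite ler_pM2r ?invr_gt0.
move: qG qpi decay trunc'; rewrite !ler_norml; lra.
Qed.

(** * Expectations of bounded functions *)

Section real_expectation.
Context {d : measure_display} {T : measurableType d} {R : realType}.
Variable P : probability T R.
Implicit Types f g W : T -> R.

Lemma fine_expectationE f : fine 'E_P[f] = \int[P]_w f w.
Proof. by rewrite unlock. Qed.

Lemma integrable_addr f g :
  P.-integrable [set: T] (EFin \o f) -> P.-integrable [set: T] (EFin \o g) ->
  P.-integrable [set: T] (EFin \o (fun w => f w + g w)).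
Proof.
by move=> itf itg; apply: eq_integrable (integrableD _ itf itg).
Qed.

Lemma integrable_mull (r : R) f :
  P.-integrable [set: T] (EFin \o f) ->
  P.-integrable [set: T] (EFin \o (fun w => r * f w)).
Proof.
by move=> itf; apply: eq_integrable (integrableZl _ r itf).
Qed.

Lemma integrable_sumr (I : Type) (r : seq I) (f : I -> T -> R) :
  (forall i, P.-integrable [set: T] (EFin \o f i)) ->
  P.-integrable [set: T] (EFin \o (fun w => \sum_(i <- r) f i w)).
Proof.
move=> itf; apply: eq_integrable
  (@integrable_sum _ _ _ P _ measurableT _ r xpredT _ (fun i _ => itf i)) => //.
by move=> w _; rewrite /= sumEFin.
Qed.

Lemma Rintegral_sumr (I : Type) (r : seq I) (f : I -> T -> R) :
  (forall i, P.-integrable [set: T] (EFin \o f i)) ->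
  \int[P]_w (\sum_(i <- r) f i w) = \sum_(i <- r) \int[P]_w f i w.
Proof.
move=> itf; elim: r => [|i r IH].
  under eq_Rintegral do rewrite big_nil.
  by rewrite big_nil Rintegral_cst// mul0r.
rewrite big_cons -IH -RintegralD//; last exact: integrable_sumr.
by apply: eq_Rintegral => w _; rewrite big_cons.
Qed.

Lemma bounded_integrable f (M : R) :
  measurable_fun [set: T] f -> (forall w, `|f w| <= M) ->
  P.-integrable [set: T] (EFin \o f).
Proof.
move=> mf fM; apply: measurable_bounded_integrable => //.
  by rewrite [X in (X < _)%E](probability_setT P) ltry.
exists M; split; first by rewrite num_real.
by move=> x Mx w _ /=; rewrite (le_trans (fM w))// ltW.
Qed.

Lemma Rintegral_probability_cst (r : R) : \int[P]_w r = r.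
Proof. by rewrite Rintegral_cst// [X in fine X](probability_setT P) mulr1. Qed.

Lemma normr_Rintegral_le f (M : R) :
  measurable_fun [set: T] f -> (forall w, `|f w| <= M) ->
  `|\int[P]_w f w| <= M.
Proof.
move=> mf fM; have itf := bounded_integrable mf fM.
apply: (le_trans (le_normr_Rintegral _ itf)) => //.
rewrite -[leRHS]Rintegral_probability_cst; apply: le_Rintegral => //.
- apply: (@bounded_integrable _ M); first exact: measurableT_comp.
  by move=> w; rewrite normr_id.
- by apply: (@bounded_integrable _ `|M|).
Qed.

Lemma Rintegral_indic_preimage (V : T -> R) (A : set R) :
  measurable_fun [set: T] V -> measurable A ->
  \int[P]_w \1_A (V w) = fine (P (V @^-1` A)).
Proof.
move=> mV mA; rewrite /Rintegral; congr fine.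
rewrite -[in RHS](setIT (V @^-1` A)) -integral_indic//; last first.
  by rewrite -[X in measurable X]setTI; exact: mV.
Qed.

(** The rounded function [truncn (N (g + 1))] takes finitely many values, so it
    is a combination of indicators and orthogonal to [W].  Rounding changes
    [N (g + 1)] by less than [1], hence [N |E[W g(V)]| <= M] for every [N]. *)
Lemma orthogonal_indic_orthogonal W (V : T -> R) (g : R -> R) (M : R) :
  measurable_fun [set: T] W -> (forall w, `|W w| <= M) ->
  measurable_fun [set: T] V ->
  (forall A, measurable A -> \int[P]_w (W w * \1_A (V w)) = 0) ->
  measurable_fun [set: R] g -> (forall x, `|g x| <= 1) ->
  \int[P]_w (W w * g (V w)) = 0.
Proof.
move=> mW WM mV W0 mg g1.
have mgV : measurable_fun [set: T] (g \o V) by exact: measurableT_comp.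
have M0 : 0 <= M by exact: le_trans (WM point).
have itWg : P.-integrable [set: T] (EFin \o (fun w => W w * g (V w))).
  apply: (@bounded_integrable _ (M * 1)); first exact: measurable_funM.
  by move=> w; rewrite normrM ler_pM.
have itW : P.-integrable [set: T] (EFin \o W) by exact: bounded_integrable WM.
have EW0 : \int[P]_w W w = 0.
  rewrite -(W0 setT measurableT); apply: eq_Rintegral => w _.
  by rewrite indicT mulr1.
apply/eqP; rewrite -normr_eq0 eq_le normr_ge0 andbT leNgt; apply/negP => I0.
set I := (X in `|X|) in I0.
pose N := (Num.truncn (M / `|I|)).+1.
have NI : M < N%:R * `|I|.
  by rewrite -ltr_pdivrMr// truncnS_gt.
move: NI; apply/negP; rewrite -leNgt.
pose G x := N%:R * (g x + 1).
have G0 x : 0 <= G x.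
  rewrite mulr_ge0// -lerBlDr sub0r.
  by have /ler_normlP[] := g1 x; rewrite lerNl.
have GN x : G x < (2 * N).+1%:R.
  rewrite (@le_lt_trans _ _ (2 * N)%:R) ?ltr_nat//.
  rewrite natrM /G [leRHS]mulrC ler_wpM2l//.
  by have := ler_norm (g x); have := g1 x; lra.
pose A j := [set x | Num.truncn (G x) = j].
have AE j : A j = G @^-1` `[j%:R, j.+1%:R[.
  apply/seteqP; split => x /=; rewrite /A/= in_itv/=.
    by move=> <-; exact: truncn_itv.
  by move=> /truncn_def.
have mG : measurable_fun [set: R] G.
  by apply: measurable_funM => //; exact: measurable_funD.
have mA j : measurable (A j).
  by rewrite AE -[X in measurable X]setTI; apply: mG.
have truncE x :
    (Num.truncn (G x))%:R = \sum_(j < (2 * N).+1) j%:R * \1_(A j) x :> R.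
  have tN : (Num.truncn (G x) < (2 * N).+1)%N.
    rewrite -(ltr_nat R); apply: le_lt_trans (GN x).
    by have /andP[] := truncn_itv (G0 x).
  rewrite (bigD1 (Ordinal tN))//= indicE mem_set// mulr1 big1 ?addr0// => j ji.
  rewrite indicE memNset ?mulr0//= => tj; move: ji.
  by rewrite -(inj_eq val_inj)/= tj eqxx.
have itWA j : P.-integrable [set: T] (EFin \o (fun w => W w * \1_(A j) (V w))).
  apply: (@bounded_integrable _ (M * 1)).
    apply: measurable_funM => //.
    by apply: measurableT_comp mV; exact: measurable_indic.
  by move=> w; rewrite normrM ler_pM// ger0_norm// indicE lern1 leq_b1.
have Wtrunc w : W w * (Num.truncn (G (V w)))%:R =
    \sum_(j < (2 * N).+1) j%:R * (W w * \1_(A j) (V w)).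
  by rewrite truncE mulr_sumr; apply: eq_bigr => j _; rewrite mulrCA.
have itWt : P.-integrable [set: T]
    (EFin \o (fun w => W w * (Num.truncn (G (V w)))%:R)).
  rewrite (funext Wtrunc); apply: integrable_sumr => j.
  exact/integrable_mull/itWA.
have ortho : \int[P]_w (W w * (Num.truncn (G (V w)))%:R) = 0.
  rewrite (funext Wtrunc) Rintegral_sumr; last first.
    by move=> j; apply: integrable_mull; exact: itWA.
  by rewrite big1// => j _; rewrite RintegralZl// W0// mulr0.
have GE w : W w * G (V w) = N%:R * (W w * g (V w)) + N%:R * W w.
  by rewrite /G; ring.
have itWG : P.-integrable [set: T] (EFin \o (fun w => W w * G (V w))).
  by rewrite (funext GE); apply: integrable_addr; exact: integrable_mull.
have EG : \int[P]_w (W w * G (V w)) = N%:R * I.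
  rewrite (funext GE).
  rewrite RintegralD//; try exact: integrable_mull.
  by rewrite !RintegralZl// EW0 mulr0 addr0.
have <- : `|N%:R * I| = N%:R * `|I| by rewrite normrM normr_nat.
rewrite -EG -[X in `|X|]subr0 -ortho -RintegralB//.
apply: normr_Rintegral_le.
  apply: measurable_funB.
    by have /measurable_int/measurable_EFinP := itWG.
  by have /measurable_int/measurable_EFinP := itWt.
move=> w; rewrite -mulrBr normrM -[leRHS]mulr1 ler_pM//.
have /andP[t1 t2] := truncn_itv (G0 (V w)).
by rewrite ger0_norm ?subr_ge0// lerBlDl natr1 ltW.
Qed.
End real_expectation.

(** * Complex functions with values in the unit disk *)

(** A class containing indicators and [e^(i f)], closed under products, and
    on which [cexpectation] is computed from integrable functions. *)
Definition disk_valued (d : measure_display) (T : measurableType d)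
    (R : realType) (Z : T -> R[i]) : Prop :=
  [/\ measurable_fun [set: T] (fun w => complex.Re (Z w)),
      measurable_fun [set: T] (fun w => complex.Im (Z w)) &
      forall w, normc (Z w) <= 1].

Section disk_valued.
Context {d : measure_display} {T : measurableType d} {R : realType}.
Implicit Types Z : T -> R[i].

Lemma disk_valuedM Z1 Z2 : disk_valued Z1 -> disk_valued Z2 ->
  disk_valued (fun w => Z1 w * Z2 w).
Proof.
move=> [mr1 mi1 n1] [mr2 mi2 n2]; split.
- rewrite (_ : (fun _ => _) = (fun w => complex.Re (Z1 w) * complex.Re (Z2 w) -
     complex.Im (Z1 w) * complex.Im (Z2 w))); last first.
    by apply/funext => w; case: (Z1 w) => ? ?; case: (Z2 w).
  by apply: measurable_funB; exact: measurable_funM.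
- rewrite (_ : (fun _ => _) = (fun w => complex.Re (Z1 w) * complex.Im (Z2 w) +
     complex.Im (Z1 w) * complex.Re (Z2 w))); last first.
    by apply/funext => w; case: (Z1 w) => ? ?; case: (Z2 w).
  by apply: measurable_funD; exact: measurable_funM.
- by move=> w; rewrite normcM mulr_ile1 ?normc_ge0.
Qed.

Lemma disk_valued1 : disk_valued (fun _ : T => 1 : R[i]).
Proof. by split=> [| |w]; rewrite ?normc1//; exact: measurable_cst. Qed.

Lemma disk_valued_prod (I : Type) (r : seq I) (Q : pred I)
    (Z : I -> T -> R[i]) :
  (forall i, disk_valued (Z i)) ->
  disk_valued (fun w => \prod_(i <- r | Q i) Z i w).
Proof.
move=> dZ; elim: r => [|i r IH].
  under eq_fun do rewrite big_nil; exact: disk_valued1.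
under eq_fun do rewrite big_cons.
by case: (Q i) => //; exact: disk_valuedM.
Qed.

Lemma disk_valued_expi (f : T -> R) : measurable_fun [set: T] f ->
  disk_valued (fun w => expi (f w)).
Proof.
move=> mf; split => [| |w]; last by rewrite normc_expi.
- apply: measurableT_comp mf.
  by apply: continuous_measurable_fun; exact: continuous_cos.
- apply: measurableT_comp mf.
  by apply: continuous_measurable_fun; exact: continuous_sin.
Qed.

Lemma disk_valued_indic (A : set T) : measurable A ->
  disk_valued (fun w => (\1_A w : R)%:C).
Proof.
move=> mA; split => [| |w]; first exact: measurable_indic.
  exact: measurable_cst.
by rewrite normc_real ger0_norm// indicE lern1 leq_b1.
Qed.

Lemma disk_valued_Re_le Z : disk_valued Z -> forall w, `|complex.Re (Z w)| <= 1.
Proof. by move=> [_ _ Z1] w; exact: le_trans (normc_ge_Re _) (Z1 w). Qed.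

Lemma disk_valued_Im_le Z : disk_valued Z -> forall w, `|complex.Im (Z w)| <= 1.
Proof. by move=> [_ _ Z1] w; exact: le_trans (normc_ge_Im _) (Z1 w). Qed.

End disk_valued.

Lemma disk_valued_comp d d' (T : measurableType d) (T' : measurableType d')
    (R : realType) (Z : T' -> R[i]) (V : T -> T') :
  measurable_fun [set: T] V -> disk_valued Z -> disk_valued (fun w => Z (V w)).
Proof.
move=> mV [mr mi n1]; split=> //.
- exact: (measurableT_comp mr mV).
- exact: (measurableT_comp mi mV).
Qed.

Section cexpectation_theory.
Context {d : measure_display} {T : measurableType d} {R : realType}.
Variable P : probability T R.
Implicit Types Z : T -> R[i].
Local Notation cE := (cexpectation P).

Lemma cexpectationE Z : cE Z =
  Complex (\int[P]_w complex.Re (Z w)) (\int[P]_w complex.Im (Z w)).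
Proof. by rewrite /cexpectation !fine_expectationE. Qed.

Lemma disk_valued_Re_integrable Z : disk_valued Z ->
  P.-integrable [set: T] (EFin \o (fun w => complex.Re (Z w))).
Proof.
move=> dZ; apply: (@bounded_integrable _ _ _ P _ 1); first by case: dZ.
exact: disk_valued_Re_le.
Qed.

Lemma disk_valued_Im_integrable Z : disk_valued Z ->
  P.-integrable [set: T] (EFin \o (fun w => complex.Im (Z w))).
Proof.
move=> dZ; apply: (@bounded_integrable _ _ _ P _ 1); first by case: dZ.
exact: disk_valued_Im_le.
Qed.

Lemma cexpectationZl (c : R[i]) Z : disk_valued Z ->
  cE (fun w => c * Z w) = c * cE Z.
Proof.
move=> dZ; rewrite !cexpectationE.
have iR := disk_valued_Re_integrable dZ.
have iI := disk_valued_Im_integrable dZ.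
apply/eqP; rewrite eq_complex Re_mul Im_mul /=; apply/andP; split; apply/eqP.
- under eq_Rintegral do rewrite Re_mul.
  by rewrite RintegralB ?RintegralZl//; exact: integrable_mull.
- under eq_Rintegral do rewrite Im_mul.
  by rewrite RintegralD ?RintegralZl//; exact: integrable_mull.
Qed.

(** Rotate by the conjugate of the mean: [|E Z|^2 = E Re (c Z) <= |E Z|]. *)
Lemma normc_cexpectation_le1 Z : disk_valued Z -> normc (cE Z) <= 1.
Proof.
move=> dZ; rewrite leNgt; apply/negP => n1.
pose c := (cE Z)^*.
have nc : normc c = normc (cE Z).
  by rewrite /c; case: (cE Z) => a b /=; rewrite sqrrN.
have : normc (cE Z) ^+ 2 <= normc (cE Z).
  rewrite -[leLHS]ger0_norm ?sqr_ge0//.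
  have -> : normc (cE Z) ^+ 2 = \int[P]_w (complex.Re (c * Z w)).
    have : complex.Re (cE (fun w => c * Z w)) = normc (cE Z) ^+ 2.
      rewrite cexpectationZl// /c; case: (cE Z) => a b /=.
      by rewrite sqr_sqrtr ?addr_ge0 ?sqr_ge0//; ring.
    by rewrite cexpectationE.
  apply: normr_Rintegral_le.
    under eq_fun do rewrite Re_mul; case: dZ => mr mi _.
    by apply: measurable_funB; exact: measurable_funM.
  move=> w; apply: le_trans (normc_ge_Re _) _; rewrite normcM nc.
  by case: dZ => _ _ Z1; rewrite ler_piMr ?normc_ge0.
rewrite expr2 ger_pMl ?(lt_trans _ n1)//; lra.
Qed.

(** If [W] integrates indicators of [V] as if it were the constant [Q], it
    does so for every [f (V)]: both components of [W - Q] are orthogonal to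
    all indicators of [V]. *)
Lemma cexpectation_factor (W : T -> R[i]) (V : T -> R) (Q : R[i]) :
  disk_valued W -> measurable_fun [set: T] V ->
  (forall A, measurable A -> cE (fun w => W w * (\1_A (V w))%:C) =
     Q * (fine (P (V @^-1` A)))%:C) ->
  forall f : R -> R[i], disk_valued f ->
  cE (fun w => W w * f (V w)) = Q * cE (fun w => f (V w)).
Proof.
move=> dW mV WQ f df.
have [mWr mWi _] := dW; have [mfr mfi _] := df.
have dfV := disk_valued_comp mV df.
have mind A : measurable A -> measurable_fun [set: T] (fun w => \1_A (V w) : R).
  by move=> mA; apply: measurableT_comp mV; exact: measurable_indic.
have ind1 (A : set R) w : `|\1_A (V w) : R| <= 1.
  by rewrite ger0_norm// indicE lern1 leq_b1.
have key (U : T -> R) (q : R) (g : R -> R) : measurable_fun [set: T] U ->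
    (forall w, `|U w| <= 1) ->
    (forall A, measurable A ->
      \int[P]_w (U w * \1_A (V w)) = q * fine (P (V @^-1` A))) ->
    measurable_fun [set: R] g -> (forall x, `|g x| <= 1) ->
    \int[P]_w (U w * g (V w)) = q * \int[P]_w g (V w).
  move=> mU U1 Uq mg g1.
  have igV : P.-integrable [set: T] (EFin \o (fun w => g (V w))).
    by apply: (@bounded_integrable _ _ _ P _ 1) => //; exact: measurableT_comp.
  have iUg : P.-integrable [set: T] (EFin \o (fun w => U w * g (V w))).
    apply: (@bounded_integrable _ _ _ P _ 1).
      by apply: measurable_funM => //; exact: measurableT_comp.
    by move=> w; rewrite normrM mulr_ile1.
  apply/eqP; rewrite -subr_eq0 -RintegralZl// -RintegralB//; last first.
    exact: integrable_mull.
  under eq_Rintegral do rewrite -mulrBl.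
  apply/eqP.
  apply: (@orthogonal_indic_orthogonal _ _ _ P _ V g (1 + `|q|)) => //.
  - exact: measurable_funB.
  - by move=> w; rewrite (le_trans (ler_normB _ _))// lerD2r.
  - move=> A mA; under eq_Rintegral do rewrite mulrBl.
    rewrite RintegralB//; last 2 first.
    + apply: (@bounded_integrable _ _ _ P _ 1).
        by apply: measurable_funM => //; exact: mind.
      by move=> w; rewrite normrM mulr_ile1.
    + apply: integrable_mull; apply: (@bounded_integrable _ _ _ P _ 1) => //.
      exact: mind.
    rewrite Uq// RintegralZl//; last first.
      by apply: (@bounded_integrable _ _ _ P _ 1) => //; exact: mind.
    by rewrite Rintegral_indic_preimage// subrr.
have WrQ A : measurable A -> \int[P]_w (complex.Re (W w) * \1_A (V w)) =
    complex.Re Q * fine (P (V @^-1` A)).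
  move=> mA; have := congr1 (@complex.Re R) (WQ A mA).
  rewrite cexpectationE Re_mul /= mulr0 subr0 => <-; apply: eq_Rintegral => w _.
  by rewrite Re_mul /= mulr0 subr0.
have WiQ A : measurable A -> \int[P]_w (complex.Im (W w) * \1_A (V w)) =
    complex.Im Q * fine (P (V @^-1` A)).
  move=> mA; have := congr1 (@complex.Im R) (WQ A mA).
  rewrite cexpectationE Im_mul /= mulr0 add0r => <-; apply: eq_Rintegral => w _.
  by rewrite Im_mul /= mulr0 add0r.
have iM (g h : T -> R) :
    measurable_fun [set: T] g -> measurable_fun [set: T] h ->
    (forall w, `|g w| <= 1) -> (forall w, `|h w| <= 1) ->
    P.-integrable [set: T] (EFin \o (fun w => g w * h w)).
  move=> mg mh g1 h1; apply: (@bounded_integrable _ _ _ P _ 1).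
    exact: measurable_funM.
  by move=> w; rewrite normrM mulr_ile1.
have [mfVr mfVi _] := dfV.
have Wr1 := disk_valued_Re_le dW; have Wi1 := disk_valued_Im_le dW.
have fr1 := disk_valued_Re_le df; have fi1 := disk_valued_Im_le df.
rewrite !cexpectationE; apply/eqP; rewrite eq_complex Re_mul Im_mul /=.
apply/andP; split; apply/eqP.
- under eq_Rintegral do rewrite Re_mul.
  rewrite RintegralB//; [|exact: iM..].
  by rewrite (key _ _ (fun x => complex.Re (f x)) mWr Wr1 WrQ)//
    (key _ _ (fun x => complex.Im (f x)) mWi Wi1 WiQ).
- under eq_Rintegral do rewrite Im_mul.
  rewrite RintegralD//; [|exact: iM..].
  by rewrite (key _ _ (fun x => complex.Im (f x)) mWr Wr1 WrQ)//
    (key _ _ (fun x => complex.Re (f x)) mWi Wi1 WiQ).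
Qed.

End cexpectation_theory.

(** * Independence and products *)

(** The hypothesis is the case where every factor is an indicator.  Indicators
    are replaced by the functions [f i] one coordinate after the other; [h r A]
    has [f i] on the coordinates of [r] and indicators elsewhere. *)
Lemma cexpectation_prod (d : measure_display) (T : measurableType d)
    (R : realType) (P : probability T R) (I : finType) (X : I -> {RV P >-> R})
    (f : I -> R -> R[i]) :
  independent_RVs X -> (forall i, disk_valued (f i)) ->
  cexpectation P (fun w => \prod_i f i (X i w)) =
  \prod_i cexpectation P (fun w => f i (X i w)).
Proof.
move=> indepX df.
pose h (r : seq I) (A : I -> set R) i x :=
  if i \in r then f i x else (\1_(A i) x)%:C.
suff H r A : (forall i, measurable (A i)) ->
    cexpectation P (fun w => \prod_i h r A i (X i w)) =
    \prod_i cexpectation P (fun w => h r A i (X i w)).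
  have := H (enum I) (fun=> setT) (fun=> measurableT).
  have hE i : h (enum I) (fun=> setT) i = f i.
    by apply/funext => x; rewrite /h mem_enum.
  by under eq_fun do under eq_bigr do rewrite hE;
    under [in X in _ = X -> _]eq_bigr do under eq_fun do rewrite hE.
elim: r A => [|i0 r IH] A mA.
  pose AX := \bigcap_(i in [set` [set: I]%SET]) (X i @^-1` A i).
  rewrite (_ : (fun w => _) = (fun w => (\1_AX w)%:C)); last first.
    apply/funext => w; rewrite /h/= -rmorph_prod; congr _%:C.
    have [Aw|] := pselect (AX w).
      rewrite indicE mem_set// big1// => i _; rewrite indicE mem_set//.
      by apply: Aw; rewrite /= inE.
    move=> nA; rewrite indicE memNset//; apply/eqP/prodf_eq0.
    move: nA => /existsNP [i /not_implyP[_ nAi]]; exists i => //.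
    by rewrite indicE memNset.
  have mXA i : measurable (X i @^-1` A i).
    by rewrite -[X in measurable X]setTI; exact: measurable_funP.
  have E (B : set T) : measurable B ->
      cexpectation P (fun w => (\1_B w)%:C) = (fine (P B))%:C.
    move=> mB; rewrite cexpectationE /= Rintegral_cst// mul0r.
    by congr (_ +i* _); rewrite /Rintegral integral_indic// setIT.
  rewrite E; last by apply: fin_bigcap_measurable => //; exact: finite_finset.
  rewrite indepX//.
  transitivity (\prod_i (fine (P (X i @^-1` A i)))%:C : R[i]).
    rewrite -rmorph_prod; congr _%:C.
    rewrite (_ : (\prod_(i in _) _)%E =
      (\prod_i fine (P (X i @^-1` A i)))%:E)//.
    rewrite (big_morph EFin (@EFinM R) (erefl 1%E)).
    apply: eq_big => [i|i _]; first by rewrite inE.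
    by rewrite fineK// fin_num_measure.
  by apply: eq_bigr => i _; rewrite -(E _ (mXA i)).
have dh s B i : (forall j, measurable (B j)) -> disk_valued (h s B i).
  move=> mB; rewrite /h; case: (i \in s); first exact: df.
  exact: disk_valued_indic.
have [i0r|i0r] := boolP (i0 \in r).
  have hE i : h (i0 :: r) A i = h r A i.
    by apply/funext => x; rewrite /h inE; case: eqP => [->|//]; rewrite i0r.
  by under eq_fun do under eq_bigr do rewrite hE;
    under [in RHS]eq_bigr do under eq_fun do rewrite hE; exact: IH.
pose W w := \prod_(i | i != i0) h r A i (X i w).
have hi0 x : h (i0 :: r) A i0 x = f i0 x by rewrite /h mem_head.
have hiN i : i != i0 -> h (i0 :: r) A i = h r A i.
  by move=> ii0; apply/funext => x; rewrite /h inE (negbTE ii0).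
rewrite (_ : (fun w => _) = (fun w => W w * f i0 (X i0 w))); last first.
  apply/funext => w; rewrite (bigD1 i0)//= hi0 mulrC; congr (_ * _).
  by apply: eq_bigr => i ii0; rewrite hiN.
rewrite [RHS](bigD1 i0)//= mulrC.
rewrite (@cexpectation_factor _ _ _ P W (X i0)
  (\prod_(i | i != i0) cexpectation P (fun w => h r A i (X i w)))
  _ _ _ (f i0))//.
- congr (_ * _); last by congr cexpectation; apply/funext => w; rewrite hi0.
  apply: eq_bigr => i ii0; congr cexpectation.
  by apply/funext => w; rewrite hiN.
- apply: disk_valued_prod => i; apply: disk_valued_comp; last exact: dh.
  exact: measurable_funP.
move=> B mB.
pose A' i := if i == i0 then B else A i.
have mA' i : measurable (A' i) by rewrite /A'; case: ifP.
have h'i0 x : h r A' i0 x = (\1_B x)%:C by rewrite /h (negbTE i0r) /A' eqxx.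
have h'iN i : i != i0 -> h r A' i = h r A i.
  by move=> ii0; apply/funext => x; rewrite /h /A' (negbTE ii0).
have := IH A' mA'.
rewrite (_ : (fun w => _) = (fun w => W w * (\1_B (X i0 w))%:C)); last first.
  apply/funext => w; rewrite (bigD1 i0)//= h'i0 mulrC; congr (_ * _).
  by apply: eq_bigr => i ii0; rewrite h'iN.
move=> ->; rewrite [LHS](bigD1 i0)//= mulrC; congr (_ * _).
  apply: eq_bigr => i ii0; congr cexpectation.
  by apply/funext => w; rewrite h'iN.
under eq_fun do rewrite h'i0.
rewrite cexpectationE /= Rintegral_cst// mul0r.
by rewrite Rintegral_indic_preimage//; exact: measurable_funP.
Qed.

(** * Second and third moments *)

(** The coefficient [al] gives equality at the integer just below [m]; at
    the integer just above it the difference of the two sides is a nonnegative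
    multiple of the square [(th - 1/2)^2]. *)
Lemma int_cube_ge (R : realType) (m : R) : exists al : R, forall x : R,
  x \is a Num.int -> (x - m) ^+ 2 / 2 + al * (x - m) <= `|x - m| ^+ 3.
Proof.
pose th := m - (Num.floor m)%:~R.
have /andP[fm1 fm2] := floor_itv m.
rewrite intrD in fm2.
have th0 : 0 <= th by rewrite subr_ge0.
have th1 : th <= 1 by rewrite /th; lra.
exists (th / 2 - th ^+ 2) => x xint.
have : x - (Num.floor m)%:~R \is a Num.int by rewrite rpredB// intr_int.
move=> /intrP[j xj].
have -> : x - m = j%:~R - th by rewrite -xj /th; ring.
have [jN|j0] := ltP j 0.
  have : j%:~R <= -1 :> R by rewrite -[-1]/((-1)%:~R) ler_int; lia.
  move: (j%:~R) => y y1; rewrite ltr0_norm; last lra.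
  have z1 : 1 <= th - y by lra.
  have -> : y - th = - (th - y) by ring.
  move: (th - y) z1 => z z1; rewrite opprK sqrrN.
  have zz : 1 <= z ^+ 2 by rewrite expr_ge1//; lra.
  have : 0 <= z * (z ^+ 2 - z / 2 + th / 2 - th ^+ 2) by apply: mulr_ge0; nra.
  rewrite exprS; nra.
have [j2|j2] := leP 2 j.
  have : 2 <= j%:~R :> R by rewrite -[2]/(2%:~R) ler_int.
  move: (j%:~R) => y y1; rewrite ger0_norm; last lra.
  have z1 : 1 <= y - th by lra.
  move: (y - th) z1 => z z1.
  have : 0 <= z * (z ^+ 2 - z / 2 - th / 2 + th ^+ 2) by apply: mulr_ge0; nra.
  rewrite exprS; nra.
have [->|->] : j = 0 \/ j = 1 by lia.
  rewrite sub0r normrN ger0_norm// sqrrN.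
  by rewrite le_eqVlt; apply/orP; left; apply/eqP; field.
rewrite ger0_norm; last lra.
move: th0 th1; set t := th => t0 t1.
have : 0 <= (1 - t) * (2 * (t - 1 / 2) ^+ 2).
  by rewrite mulr_ge0 ?subr_ge0// mulr_ge0// sqr_ge0.
nra.
Qed.

Section moments.
Context {d : measure_display} {T : measurableType d} {R : realType}.
Variables (P : probability T R) (Y : T -> R).
Hypotheses (mY : measurable_fun [set: T] Y)
  (iY : P.-integrable [set: T] (EFin \o Y))
  (iY2 : P.-integrable [set: T] (EFin \o (fun w => Y w ^+ 2)))
  (iY3 : P.-integrable [set: T] (EFin \o (fun w => `|Y w| ^+ 3))).
Let v := \int[P]_w (Y w ^+ 2).
Let b := \int[P]_w (`|Y w| ^+ 3).

Let icst (r : R) : P.-integrable [set: T] (EFin \o (fun=> r)).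
Proof. by apply: (@bounded_integrable _ _ _ P _ `|r|). Qed.

Lemma third_moment_ge0 : 0 <= b.
Proof. by apply: Rintegral_ge0 => w _; exact: exprn_ge0. Qed.

(** Lyapunov's inequality, from integrating the tangent bound
    [y^3 >= 3/2 s y^2 - s^3/2] at [s]. *)
Lemma variance_pow_le_third_moment : Num.sqrt v ^+ 3 <= b.
Proof.
set s := Num.sqrt v; have s0 : 0 <= s by exact: sqrtr_ge0.
have v0 : 0 <= v by apply: Rintegral_ge0 => w _; exact: sqr_ge0.
have sv : s ^+ 2 = v by rewrite sqr_sqrtr.
have <- : \int[P]_w (3 / 2 * s * Y w ^+ 2 + - (s ^+ 3 / 2)) = s ^+ 3.
  rewrite RintegralD ?RintegralZl ?Rintegral_probability_cst//; last first.
    exact: integrable_mull.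
  by rewrite -/v -sv; field.
apply: le_Rintegral => //.
  by apply: integrable_addr => //; exact: integrable_mull.
move=> w _; rewrite -(@real_normK _ (Y w)) ?num_real//.
have := normr_ge0 (Y w); set y := `|Y w| => y0.
have : 0 <= (y - s) ^+ 2 * (y + s / 2).
  by rewrite mulr_ge0 ?sqr_ge0// addr_ge0// divr_ge0.
have -> : (y - s) ^+ 2 * (y + s / 2) =
    y ^+ 3 - 3 / 2 * s * y ^+ 2 + s ^+ 3 / 2 by field.
lra.
Qed.

Hypothesis Y0 : \int[P]_w Y w = 0.

Lemma cf_taylor (l : R) : 0 <= l ->
  normc (cexpectation P (fun w => expi (l * Y w)) - (1 - l ^+ 2 * v / 2)%:C) <=
  l ^+ 3 * b.
Proof.
move=> l0; apply: (le_trans (normc_le_ReIm _)).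
have dE : disk_valued (fun w => expi (l * Y w)).
  by apply: disk_valued_expi; exact: measurable_funM.
have icos : P.-integrable [set: T] (EFin \o (fun w => cos (l * Y w))).
  exact: (disk_valued_Re_integrable P dE).
have isin : P.-integrable [set: T] (EFin \o (fun w => sin (l * Y w))).
  exact: (disk_valued_Im_integrable P dE).
rewrite cexpectationE /= oppr0 addr0.
have i3 : P.-integrable [set: T] (EFin \o (fun w => l ^+ 3 / 6 * `|Y w| ^+ 3)).
  exact: integrable_mull.
have i1 : P.-integrable [set: T] (EFin \o (fun w => 1 - l ^+ 2 / 2 * Y w ^+ 2)).
  rewrite (_ : (fun w => _) = (fun w => 1 + - (l ^+ 2 / 2) * Y w ^+ 2)).
    by apply: integrable_addr => //; exact: integrable_mull.
  by apply/funext => w; rewrite mulNr.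
have bound (g h : T -> R) : P.-integrable [set: T] (EFin \o g) ->
    P.-integrable [set: T] (EFin \o h) ->
    (forall w, `|g w - h w| <= l ^+ 3 / 6 * `|Y w| ^+ 3) ->
    `|\int[P]_w g w - \int[P]_w h w| <= l ^+ 3 / 6 * b.
  move=> ig ih gh; rewrite -RintegralB//.
  have igh : P.-integrable [set: T] (EFin \o (fun w => g w - h w)).
    by apply: eq_integrable (integrableB _ ig ih).
  apply: le_trans (le_normr_Rintegral _ igh) _ => //.
  rewrite -RintegralZl//; apply: le_Rintegral => //.
  have /integrable_abse := igh; exact: eq_integrable.
have cosb : `|\int[P]_w cos (l * Y w) - (1 - l ^+ 2 * v / 2)| <= l ^+ 3 / 6 * b.
  have -> : 1 - l ^+ 2 * v / 2 = \int[P]_w (1 - l ^+ 2 / 2 * Y w ^+ 2).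
    rewrite RintegralB ?RintegralZl ?Rintegral_probability_cst//.
      by rewrite -/v; field.
    exact: integrable_mull.
  apply: bound => // w; have := cos_taylor (l * Y w).
  by rewrite normrM (ger0_norm l0) !exprMn; congr (`|_ - (1 - _)| <= _); field.
have sinb : `|\int[P]_w sin (l * Y w)| <= l ^+ 3 / 6 * b.
  rewrite -[X in `|X|]subr0 -(mulr0 l) -Y0 -RintegralZl//.
  apply: bound => //; first exact: integrable_mull.
  move=> w; have := sin_taylor (l * Y w).
  by rewrite normrM (ger0_norm l0) !exprMn; congr (_ <= _); field.
have : 0 <= l ^+ 3 * b by rewrite mulr_ge0 ?exprn_ge0// third_moment_ge0.
lra.
Qed.

Lemma lattice_variance_le_third_moment (m : R) :
  (forall w, Y w + m \is a Num.int) -> v <= 2 * b.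
Proof.
move=> Yint; have [al alP] := int_cube_ge m.
have : \int[P]_w (1 / 2 * Y w ^+ 2 + al * Y w) <= b.
  apply: le_Rintegral => //.
    by apply: integrable_addr => //; exact: integrable_mull.
  by move=> w _; have := alP _ (Yint w); rewrite addrK; lra.
rewrite RintegralD//; [|exact: integrable_mull..].
by rewrite !RintegralZl// Y0 -/v; lra.
Qed.

End moments.

(** * Fourier inversion on the integers *)

Lemma sin_pi_int (R : realType) (z : R) : z \is a Num.int -> sin (pi * z) = 0.
Proof.
have sin_nat (n : nat) : sin (pi * n%:R) = 0 :> R.
  have := alternatingn (@sinDpi R) n 0.
  by rewrite add0r sin0 mulr0 mulr_natr.
move=> /intrP[[n|n] ->]; first exact: sin_nat.
by rewrite NegzE mulrNz mulrN sinN sin_nat oppr0.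
Qed.

Lemma Rintegral_cos_int (R : realType) (z : R) : z \is a Num.int ->
  \int[leb]_(l in `[0, pi]) cos (l * z) = pi * (z == 0)%:R.
Proof.
move=> zint; have [->|z0] := eqVneq z 0.
  under eq_Rintegral do rewrite mulr0 cos0.
  rewrite Rintegral_cst//.
  by rewrite mulr1 mul1r /= lebesgue_measure_itv/= lte_fin pi_gt0 oppr0 addr0.
have dF (x : R) : is_derive x 1 (fun l => sin (l * z) / z) (cos (x * z)).
  by apply: trigger_derive; rewrite /GRing.scale/=; field.
rewrite (Rintegral_derive (pi_gt0 R) dF); last first.
  by apply: derivable_continuous => x; exact: ex_derive.
by rewrite sin_pi_int// !mul0r sin0 mul0r mulr0 subr0.
Qed.

Section lattice_inversion.
Context {d : measure_display} {T : measurableType d} {R : realType}.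
Variables (P : probability T R) (Z : T -> R).
Hypotheses (mZ : measurable_fun [set: T] Z).

Let f (x : measurableTypeR R * T) : \bar R :=
  (\1_`[0, pi] x.1 * cos (x.1 * Z x.2))%:E.

Let mf : measurable_fun [set: measurableTypeR R * T] f.
Proof.
apply/measurable_EFinP/measurable_funM.
  apply: (measurableT_comp _ measurable_fst).
  apply: measurable_indic; exact: measurable_itv.
apply: measurableT_comp.
  apply: continuous_measurable_fun; exact: continuous_cos.
apply: measurable_funM; first exact: measurable_fst.
exact: (measurableT_comp mZ measurable_snd).
Qed.

Let f_le x : (`|f x| <= (\1_(`[0, pi] : set R) x.1)%:E)%E.
Proof.
rewrite /f lee_fin normrM ger0_norm//.
by rewrite -[leRHS]mulr1 ler_pM ?cos_max.
Qed.

Let itf : (leb \x P)%E.-integrable [set: measurableTypeR R * T] f.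
Proof.
have intP (r : R) : (\int[P]_y r%:E = r%:E)%E.
  by rewrite integral_cst// [X in (_ * X)%E](probability_setT P) mule1.
apply/(integrable12ltyP leb P mf).
apply: (@le_lt_trans _ _
  (\int[leb]_x \int[P]_y (\1_(`[0, pi] : set R) x)%:E)%E).
  apply: ge0_le_integral => //.
  - by move=> x _; exact: integral_ge0.
  - apply: (measurable_fun_fubini_tonelli_F (fun x => `|f x|)%E) => //.
    exact: measurableT_comp mf.
  - under eq_fun do rewrite intP.
    by apply/measurable_EFinP; exact: measurable_indic.
  - move=> x _; apply: ge0_le_integral => //.
    apply: measurableT_comp => //.
    exact: (measurableT_comp mf (pair1_measurable x)).
under eq_integral do rewrite intP.
rewrite integral_indic// setIT /= lebesgue_measure_itv/= lte_fin pi_gt0.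
by rewrite oppr0 addr0 ltry.
Qed.

Let mcos l : measurable_fun [set: T] (fun w => cos (l * Z w)).
Proof.
apply: measurableT_comp; last exact: measurable_funM.
by apply: continuous_measurable_fun; exact: continuous_cos.
Qed.

Let F_E : (fun l => (\int[P]_w f (l, w))%E) =
  (EFin \o (fun l => \int[P]_w cos (l * Z w))) \_ (`[0, pi] : set R).
Proof.
apply/funext => l; rewrite patchE.
have [l0|l0] := boolP (l \in (`[0, pi]%classic : set R)).
  rewrite /Rintegral /= fineK; last first.
    apply: integrable_fin_num => //; apply: (@bounded_integrable _ _ _ P _ 1).
      exact: mcos.
    by move=> w; exact: cos_max.
  by apply: eq_integral => w _; rewrite /f /= indicE l0 mul1r.
by apply: integral0_eq => w _; rewrite /f /= indicE (negbTE l0) mul0r.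
Qed.

Lemma lattice_cf_integrable :
  leb.-integrable `[0, pi] (EFin \o (fun l => \int[P]_w cos (l * Z w))).
Proof.
have := integrable_fubini_F itf; rewrite /fubini_F F_E.
by move=> H; have := (integrable_restrict _ _ _ _).2 H; rewrite setTI; apply.
Qed.

(** Fubini, after which the inner integral of [cos (l Z)] over [[0, pi]] is
    [pi] where [Z = 0] and [0] elsewhere. *)
Lemma lattice_inversion : (forall w, Z w \is a Num.int) ->
  \int[leb]_(l in `[0, pi]) (\int[P]_w cos (l * Z w)) =
  pi * fine (P [set w | Z w = 0]).
Proof.
move=> Zint; rewrite {1}/Rintegral integral_mkcond -F_E (Fubini itf).
have mZ0 : measurable [set w | Z w = 0].
  by rewrite -[X in measurable X]setTI; exact: (mZ _ (measurable_set1 0)).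
transitivity (\int[P]_w (pi * \1_[set w | Z w = 0] w)).
  congr fine; apply: eq_integral => w _.
  rewrite (_ : (fun l => f (l, w)) =
      (EFin \o (fun l => cos (l * Z w))) \_ (`[0, pi] : set R)).
    rewrite -integral_mkcond -[LHS]fineK; last first.
      apply: integrable_fin_num => //; apply: continuous_itv_integrable.
      by apply: derivable_continuous => x; exact: ex_derive.
    congr _%:E; rewrite -/(Rintegral _ _ _) Rintegral_cos_int// indicE.
    congr (_ * (nat_of_bool _)%:R).
    by apply/eqP/idP => [Zw0|/set_mem//]; exact: mem_set.
  apply/funext => l; rewrite patchE /f/= indicE.
  by case: ifP => _; rewrite ?mul1r ?mul0r.
rewrite RintegralZl//; last first.
  apply: (@bounded_integrable _ _ _ P _ 1) => // w.
  by rewrite ger0_norm// indicE lern1 leq_b1.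
by rewrite /Rintegral integral_indic// setIT.
Qed.
End lattice_inversion.

(** * The local limit theorem *)

Section centered_moments.
Context {d : measure_display} {T : measurableType d} {R : realType}.
Variables (P : probability T R) (X : {RV P >-> R}).
Hypothesis X1 : (X : T -> R) \in Lfun P 1.
Let m := fine 'E_P[X].
Let Y w := X w - m.

Lemma measurable_centered : measurable_fun [set: T] Y.
Proof. by apply: measurable_funB => //; exact: measurable_funP. Qed.

Let iX : P.-integrable [set: T] (EFin \o X).
Proof. exact/Lfun1_integrable. Qed.

Let icst (r : R) : P.-integrable [set: T] (EFin \o (fun=> r)).
Proof. by apply: (@bounded_integrable _ _ _ P _ `|r|). Qed.

Lemma integrable_centered : P.-integrable [set: T] (EFin \o Y).
Proof. exact: (integrable_addr iX (icst (- m))). Qed.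

Lemma Rintegral_centered : \int[P]_w Y w = 0.
Proof.
rewrite (RintegralB measurableT iX (icst m)) Rintegral_probability_cst.
by rewrite -fine_expectationE subrr.
Qed.

Lemma varianceEint : 'V_P[X] = (\int[P]_w (Y w ^+ 2)%:E)%E.
Proof. by rewrite /variance /Y /m !unlock. Qed.

Lemma integrable_centered_sqr : ('V_P[X] < +oo)%E ->
  P.-integrable [set: T] (EFin \o (fun w => Y w ^+ 2)).
Proof.
rewrite varianceEint => Voo; apply/integrableP; split.
  by apply/measurable_EFinP; apply: measurable_funX; exact: measurable_centered.
by under eq_integral do rewrite /= ger0_norm ?sqr_ge0//.
Qed.

Lemma integrable_centered_cube : ('E_P[fun w => (`|Y w| ^+ 3)%R] < +oo)%E ->
  P.-integrable [set: T] (EFin \o (fun w => `|Y w| ^+ 3)).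
Proof.
rewrite unlock => Eoo; apply/integrableP; split.
  apply/measurable_EFinP; apply: measurable_funX.
  by apply: measurableT_comp => //; exact: measurable_centered.
by under eq_integral do rewrite /= ger0_norm ?exprn_ge0//.
Qed.

End centered_moments.

Section local_limit.
Context {d : measure_display} {T : measurableType d} {R : realType}.
Variables (P : probability T R) (I : finType) (X : I -> {RV P >-> R}).
Let m i := fine 'E_P[X i].
Let Y i w := X i w - m i.
Let v i := \int[P]_w (Y i w ^+ 2).
Let b i := \int[P]_w (`|Y i w| ^+ 3).
Let S w := \sum_i X i w.
Let V := \sum_i v i.
Let B := \sum_i b i.
Let s := Num.sqrt V.
Hypotheses (indepX : independent_RVs X) (Xint : forall i, integer_valued (X i))
  (X1 : forall i, (X i : T -> R) \in Lfun P 1)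
  (X2 : forall i, ('V_P[X i] < +oo)%E)
  (X3 : forall i, ('E_P[fun w => (`|X i w - m i| ^+ 3)%R] < +oo)%E)
  (s0 : 0 < s) (monoS : monotone_RV P S).
Variables (t : R).
Let n := \sum_i m i + t * s.
Hypothesis nint : n \is a Num.int.

Let mY i : measurable_fun [set: T] (Y i).
Proof. exact: measurable_centered. Qed.
Let iY i : P.-integrable [set: T] (EFin \o Y i).
Proof. exact: integrable_centered. Qed.
Let iY2 i : P.-integrable [set: T] (EFin \o (fun w => Y i w ^+ 2)).
Proof. exact: integrable_centered_sqr. Qed.
Let iY3 i : P.-integrable [set: T] (EFin \o (fun w => `|Y i w| ^+ 3)).
Proof. exact: integrable_centered_cube. Qed.
Let Y0 i : \int[P]_w Y i w = 0. Proof. exact: Rintegral_centered. Qed.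

Let v0 i : 0 <= v i. Proof. by apply: Rintegral_ge0 => w _; exact: sqr_ge0. Qed.
Let b0 i : 0 <= b i. Proof. exact: third_moment_ge0. Qed.
Let V_gt0 : 0 < V. Proof. by rewrite -sqrtr_gt0. Qed.
Let sV : s ^+ 2 = V. Proof. by rewrite sqr_sqrtr// ltW. Qed.

(** Together with [s^2 = V] this gives [s^-1 <= 2 L]. *)
Let V_le_B : V <= 2 * B.
Proof.
rewrite mulr_sumr; apply: ler_sum => i _.
apply: (@lattice_variance_le_third_moment _ _ _ P (Y i) _ _ _ _ (m i)) => // w.
by rewrite subrK; exact: Xint.
Qed.

Let B_gt0 : 0 < B. Proof. by have := V_gt0; have := V_le_B; lra. Qed.

Let L := B / s ^+ 3.

Let L0 : 0 < L. Proof. by rewrite divr_gt0// exprn_gt0. Qed.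

Let sV_le : s^-1 <= 2 * L.
Proof.
have -> : s^-1 = V / s ^+ 3 by rewrite -sV; field; rewrite gt_eqF.
by rewrite /L mulrA ler_pM2r ?invr_gt0 ?exprn_gt0.
Qed.

Let z l i := cexpectation P (fun w => expi (l * Y i w)).
Let psi l := \prod_i z l i.

Let mS : measurable_fun [set: T] S.
Proof. by apply: measurable_sum => i; exact: measurable_funP. Qed.

Let psiE l : psi l = cexpectation P (fun w => expi (l * \sum_i Y i w)).
Proof.
rewrite /psi /z.
rewrite -(@cexpectation_prod _ _ _ P I X (fun i x => expi (l * (x - m i))))//.
  by congr cexpectation; apply/funext => w; rewrite mulr_sumr expi_sum.
move=> i; apply: disk_valued_expi; apply: measurable_funM => //.
by apply: measurable_funB.
Qed.

Let sumY w : \sum_i Y i w = S w - \sum_i m i.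
Proof. by rewrite sumrB. Qed.

Let psi_char_fun l : normc (psi l) = normc (char_fun P S l).
Proof.
rewrite psiE (_ : (fun w => _) =
    (fun w => expi (- (l * \sum_i m i)) * expi (l * S w))); last first.
  by apply/funext => w; rewrite sumY -expiD; congr expi; ring.
rewrite cexpectationZl ?normcM ?normc_expi ?mul1r//.
by apply: disk_valued_expi; exact: measurable_funM.
Qed.

Let q l := \int[P]_w cos (l * (S w - n)).

Let qE l : q l = complex.Re (expi (- (l * (t * s))) * psi l).
Proof.
rewrite psiE -cexpectationZl.
  rewrite cexpectationE; apply: eq_Rintegral => w _.
  by rewrite -expiD /= sumY /n; congr cos; ring.
apply: disk_valued_expi; apply: measurable_funM => //.
by apply: measurable_sum => i; exact: mY.
Qed.

Let q_le l : `|q l| <= normc (psi l).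
Proof.
by rewrite qE (le_trans (normc_ge_Re _))// normcM normc_expi mul1r.
Qed.

Let q_gauss l (r : R) : `|q l - r * cos (t * (s * l))| <= normc (psi l - r%:C).
Proof.
have -> : q l - r * cos (t * (s * l)) =
    complex.Re (expi (- (l * (t * s))) * (psi l - r%:C)).
  rewrite qE mulrBr raddfB/= Re_mul /= mulr0 subr0 [r * _]mulrC cosN.
  by congr (_ - cos _ * _); ring.
by rewrite (le_trans (normc_ge_Re _))// normcM normc_expi mul1r.
Qed.

(** Centering multiplies the characteristic function by a unimodular factor,
    so monotonicity passes from [char_fun P S] to [psi]. *)
Let psi_mono l l' : 0 <= l -> l <= l' -> l' <= pi ->
  normc (psi l') <= normc (psi l).
Proof.
move=> l0 ll' lpi; have := monoS l0 ll' lpi.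
by rewrite !psi_char_fun lecR.
Qed.

Let z1 l i : normc (z l i) <= 1.
Proof.
apply: normc_cexpectation_le1; apply: disk_valued_expi.
exact: measurable_funM.
Qed.

Let zE l i : 0 <= l ->
  normc (z l i - (1 - (l * Num.sqrt (v i)) ^+ 2 / 2)%:C) <= l ^+ 3 * b i.
Proof. by move=> l0; rewrite exprMn sqr_sqrtr// cf_taylor. Qed.

Let sb i : Num.sqrt (v i) ^+ 3 <= b i.
Proof. exact: variance_pow_le_third_moment. Qed.

Let sumv : \sum_i Num.sqrt (v i) ^+ 2 = V.
Proof. by apply: eq_bigr => i _; rewrite sqr_sqrtr. Qed.

Let p := fine (P [set w | S w = n]).
Let g := (Num.sqrt (2 * pi) * s)^-1 * expR (- t ^+ 2 / 2).

Let p01 : 0 <= p <= 1.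
Proof.
have mA : measurable [set w | S w = n].
  by rewrite -[X in measurable X]setTI; exact: (mS _ (measurable_set1 n)).
apply/andP; split; first by rewrite fine_ge0.
by rewrite -lee_fin fineK ?fin_num_measure// probability_le1.
Qed.

Let sqrt2pi_ge1 : 1 <= Num.sqrt (2 * pi) :> R.
Proof. by rewrite -[leLHS]sqrtr1 ler_wsqrtr//; have := @pi_ge2 R; lra. Qed.

Let g_ge0 : 0 <= g.
Proof. by rewrite mulr_ge0 ?expR_ge0// invr_ge0 mulr_ge0 ?sqrtr_ge0// ltW. Qed.

Let g_le : g <= s^-1.
Proof.
rewrite /g invfM -[leRHS]mulr1 -[leRHS]mul1r mulrA.
rewrite ler_pM ?expR_ge0 ?mulr_ge0 ?invr_ge0 ?sqrtr_ge0 ?(ltW s0)//.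
  rewrite ler_pM2r ?invr_gt0// invf_le1// (lt_le_trans _ sqrt2pi_ge1)//.
by rewrite -[leRHS]expR0 ler_expR; have := sqr_ge0 t; lra.
Qed.

(** Here [1 <= 64 L^2] and [g <= s^-1 <= 2 L], so both quantities are already
    smaller than the bound. *)
Let llt_large_ratio : 1 / 8 <= L -> `|p - g| <= 256 * L ^+ 2.
Proof.
move=> L8; have /andP[p0 p1] := p01.
have : L * (1 / 8) <= L ^+ 2 by rewrite expr2 ler_pM2l.
have := le_trans g_le sV_le; have := g_ge0; rewrite ler_norml; lra.
Qed.

Let llt_small_ratio : L < 1 / 8 -> `|p - g| <= 256 * L ^+ 2.
Proof.
move=> L8.
(* the largest frequency at which the third-order error l^3 B is still at
   most half of the Gaussian exponent l^2 V / 2 *)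
pose a := V / (4 * B).
have a0 : 0 < a by rewrite divr_gt0// mulr_gt0.
have Bn0 : B != 0 by rewrite gt_eqF.
have sn0 : s != 0 by rewrite gt_eqF.
have aB : a * B = V / 4 by rewrite /a; field.
have a1 : a <= 1.
  by rewrite ler_pdivrMr ?mulr_gt0//; have := V_le_B; have := B_gt0; lra.
have api : a <= pi by have := @pi_ge2 R; lra.
have sa : s * a = (4 * L)^-1.
  by rewrite /a /L -sV; field; rewrite ?Bn0 ?sn0.
(* a variance above V / 4 would force L >= 1/8 *)
have siV i : Num.sqrt (v i) ^+ 2 <= V / 4.
  have : Num.sqrt (v i) <= s / 2.
    rewrite -(@ler_pXn2r _ 3)// ?nnegrE ?sqrtr_ge0 ?divr_ge0 ?(ltW s0)//.
    apply: le_trans (sb i) _; apply: (@le_trans _ _ B).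
      by rewrite /B (bigD1 i)//= lerDl sumr_ge0.
    have -> : B = L * s ^+ 3 by rewrite /L mulfVK// gt_eqF// exprn_gt0.
    have -> : (s / 2) ^+ 3 = 1 / 8 * s ^+ 3 by field.
    by rewrite ler_pM2r ?exprn_gt0// ltW.
  rewrite -sV; have := sqrtr_ge0 (v i) => h1 h2.
  have -> : s ^+ 2 / 4 = (s / 2) ^+ 2 by field.
  by rewrite ler_sqr ?nnegrE// divr_ge0// ltW.
have lB l : l <= a -> 4 * (l * B) <= \sum_i Num.sqrt (v i) ^+ 2.
  move=> la; rewrite sumv.
  have : l * B <= a * B by rewrite ler_wpM2r// ltW.
  rewrite aB; lra.
have near0 l : 0 <= l <= a ->
    `|q l - expR (- ((s * l) ^+ 2 / 2)) * cos (t * (s * l))| <=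
    2 * B * (l ^+ 3 * expR (- (l ^+ 2 * s ^+ 2 / 8))).
  move=> /andP[l0 la]; apply: le_trans (q_gauss _ _) _.
  have := @normc_prod_cf_gauss_le R I l (fun i => Num.sqrt (v i)) b (z l) l0
    (fun i => sqrtr_ge0 _) sb (z1 l) (fun i => zE i l0) (lB l la).
  rewrite sumv => /(_ siV); rewrite -/(psi l) -/B sV.
  have -> : (s * l) ^+ 2 = l ^+ 2 * V by rewrite exprMn sV mulrC.
  by move/le_trans; apply; rewrite le_eqVlt; apply/orP; left; apply/eqP; ring.
have psia : normc (psi a) <= expR (- ((s * a) ^+ 2 / 4)).
  have := @normc_prod_cf_le R I a (fun i => Num.sqrt (v i)) b (z a) (ltW a0)
    (fun i => sqrtr_ge0 _) sb (z1 a) (fun i => zE i (ltW a0)) (lB a (lexx _)).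
  by rewrite sumv -sV; congr (_ <= expR (- (_ / 4))); ring.
have far l : a <= l <= pi -> `|q l| <= expR (- ((s * a) ^+ 2 / 4)).
  move=> /andP[al lpi]; apply: le_trans (q_le l) _; apply: le_trans psia.
  exact: psi_mono (ltW a0) al lpi.
have mSn : measurable_fun [set: T] (fun w => S w - n) by exact: measurable_funB.
have Snint w : S w - n \is a Num.int.
  by rewrite rpredB// rpred_sum// => i _; exact: Xint.
have D0 : 0 <= 2 * B by rewrite mulr_ge0// ltW.
have := fourier_gauss_bound s0 a0 api D0
  (lattice_cf_integrable P mSn) near0 far.
rewrite lattice_inversion//.
rewrite (_ : [set w | S w - n = 0] = [set w | S w = n]); last first.
  by apply/seteqP; split => w /=; [move/subr0_eq|move=> ->; rewrite subrr].
rewrite -/p.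
have -> : Num.sqrt (2 * pi) / (2 * s) * expR (- (t ^+ 2 / 2)) = pi * g.
  rewrite /g mulNr mulrA; congr (_ * _).
  have := @sqr_sqrtr R (2 * pi); rewrite mulr_ge0 ?pi_ge0// => /(_ isT).
  have : Num.sqrt (2 * pi) != 0 :> R.
    by rewrite gt_eqF// (lt_le_trans _ sqrt2pi_ge1).
  move: (Num.sqrt (2 * pi)) => r r0 r2.
  have -> : pi = r ^+ 2 / 2 :> R by rewrite r2; field.
  by field; rewrite r0 gt_eqF.
rewrite -mulrBr normrM ger0_norm ?pi_ge0//.
have -> : 2 * B * (32 / s ^+ 4) = 64 * (L * s^-1).
  by rewrite /L; field; rewrite gt_eqF.
set e := expR _.
have e0 : 0 <= e by exact: expR_ge0.
have e_le : e <= 64 * L ^+ 2.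
  rewrite /e sa expRN.
  have -> : (4 * L)^-1 ^+ 2 / 4 = (64 * L ^+ 2)^-1 by field; rewrite gt_eqF.
  have L2 : 0 < 64 * L ^+ 2 by rewrite mulr_gt0// exprn_gt0.
  rewrite invf_ple ?posrE ?expR_gt0//.
  by have := expR_ge1Dx (64 * L ^+ 2)^-1; lra.
have L2 := sqr_ge0 L.
have LsV : L * s^-1 <= 2 * L ^+ 2.
  have -> : 2 * L ^+ 2 = L * (2 * L) by ring.
  by rewrite ler_pM2l.
have es : e / s <= e / 4.
  by rewrite ler_wpM2l//; have := sV_le; lra.
move=> main; have pi1 : 1 <= pi :> R by have := @pi_ge2 R; lra.
have pi0 : 0 < pi :> R by exact: pi_gt0.
rewrite -(ler_pM2l pi0).
apply: le_trans main _.
have : pi * e <= pi * (64 * L ^+ 2) by rewrite ler_pM2l.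
have : L ^+ 2 <= pi * L ^+ 2 by rewrite ler_peMl.
lra.
Qed.

Lemma local_limit_real : `|p - g| <= 256 * (B / s ^+ 3) ^+ 2.
Proof.
have [L8|L8] := leP (1 / 8) L; first exact: llt_large_ratio.
exact: llt_small_ratio.
Qed.

End local_limit.

Theorem theorem1 (R : realType) :
  exists2 c : R, 0 < c &
  forall (d : measure_display) (T : measurableType d) (P : probability T R)
    (k : nat) (X : 'I_k -> {RV P >-> R}),
    (1 <= k)%N ->
    independent_RVs X ->
    (forall j, integer_valued (X j)) ->
    (forall j, (X j : T -> R) \in Lfun P 1) ->
    (forall j, ('V_P[X j] < +oo)%E) ->
    let mu_ (j : 'I_k) : R := fine 'E_P[X j] in
    let S (w : T) : R := \sum_(j < k) X j w in
    let mu : R := \sum_(j < k) mu_ j in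
    let sigma : R := Num.sqrt (\sum_(j < k) fine 'V_P[X j]) in
    0 < sigma ->
    monotone_RV P S ->
    forall t : R, mu + t * sigma \is a Num.int ->
      (`| P [set w | S w = (mu + t * sigma)%R]
          - ((Num.sqrt (2 * pi) * sigma)^-1 * expR (- t ^+ 2 / 2))%:E |
       <= c%:E * ((\sum_(j < k) 'E_P[fun w => (`|X j w - mu_ j| ^+ 3)%R])
                  * (sigma ^- 3)%:E) ^+ 2)%E.
Proof.
exists 256 => //.
move=> d T P k X k1 indepX Xint X1 X2 mu_ S mu sigma sigma0 monoS t nint.
pose beta j := 'E_P[fun w => (`|X j w - mu_ j| ^+ 3)%R]%E.
rewrite -[(\sum_(j < k) _)%E]/(\sum_(j < k) beta j)%E.
have beta0 j : (0 <= beta j)%E by apply: expectation_ge0 => w; exact: exprn_ge0.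
have s3 : 0 < sigma ^- 3 by rewrite invr_gt0 exprn_gt0.
have [X3|/existsNP[j Xj]] := pselect (forall j, (beta j < +oo)%E); last first.
  have bj : beta j = +oo%E by apply/eqP; rewrite -leye_eq leNgt; exact/negP.
  have -> : (\sum_(j < k) beta j)%E = +oo%E.
    apply/eqP; rewrite -leye_eq (bigD1 j)//= bj -[leLHS]adde0.
    by apply: leeD => //; exact: sume_ge0.
  by rewrite gt0_mulye ?lte_fin// expe2 gt0_mulye// gt0_muley ?lte_fin// leey.
have mX j : measurable_fun [set: T] (X j) by exact: measurable_funP.
have betaE j : beta j = (\int[P]_w (`|X j w - mu_ j| ^+ 3))%:E.
  rewrite /Rintegral fineK; first by rewrite /beta unlock.
  rewrite ge0_fin_numE; last exact: integral_ge0.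
  by have := X3 j; rewrite /beta unlock.
have varE : \sum_(j < k) fine 'V_P[X j] =
    \sum_(j < k) \int[P]_w ((X j w - mu_ j) ^+ 2).
  by apply: eq_bigr => j _; rewrite varianceEint.
have := @local_limit_real _ _ _ P 'I_k X indepX Xint X1 X2 X3.
rewrite -varE => /(_ sigma0 monoS t nint) main.
have PE : P [set w | S w = mu + t * sigma] =
    (fine (P [set w | S w = mu + t * sigma]))%:E.
  rewrite fineK// fin_num_measure// -[X in measurable X]setTI.
  have mS : measurable_fun [set: T] S by exact: measurable_sum.
  exact: (mS measurableT _ (measurable_set1 (mu + t * sigma))).
rewrite PE (eq_bigr _ (fun j _ => betaE j)) sumEFin -EFinM.
rewrite -EFinB lee_fin.
exact: main.
Qed.
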